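(* Let $\epsilon>0$ and $r\in\mathbb{N}$, $r\ge 1$. Then there exists $n\ge 0$ such that for every $N$, every composition $\lambda$ of $N$ and every indices $1\le i_1<i_2<\dots<i_r\le N$ with $i_{j+1}-i_j\ge n$ for all $1\le j<r$, $$d_{\pi}\Big(\mu\big(\tfrac{\sigma_\lambda(i_1)}{N},\dots,\tfrac{\sigma_\lambda(i_r)}{N}\big),\ \mu\big(\tfrac{\sigma_\lambda(i_1)}{N}\big)\otimes\dots\otimes\mu\big(\tfrac{\sigma_\lambda(i_r)}{N}\big)\Big)\le\epsilon,$$ where $d_\pi$ is the Lévy–Prokhorov metric on probability measures on $[0,1]^r$.
   Context: A composition $\lambda$ of $N$ is a finite sequence of positive integers $(\lambda_1,\dots,\lambda_k)$ with $\sum_j\lambda_j=N$; its descent set is $D_\lambda=\{\lambda_1,\lambda_1+\lambda_2,\dots,\lambda_1+\dots+\lambda_{k-1}\}\subseteq\{1,\dots,N-1\}$. A descent of a permutation $\sigma$ of $\{1,\dots,N\}$ is an $i\in\{1,\dots,N-1\}$ with $\sigma(i)>\sigma(i+1)$. $\sigma_\lambda$ denotes a uniformly random permutation of $\{1,\dots,N\}$ among those whose set of descents is exactly $D_\lambda$. For a random vector $V$, $\mu(V)$ denotes its law, and $\otimes$ denotes the product of laws. *)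

(* Defs.v *)
From Stdlib Require Import Reals ClassicalEpsilon.
From mathcomp Require Import all_boot.

Set Implicit Arguments.
Unset Strict Implicit.
Unset Printing Implicit Defensive.

Open Scope R_scope.

Definition is_composition (N : nat) (lam : seq nat) : Prop :=
  all (fun x : nat => (0 < x)%N) lam /\ sumn lam = N.

Definition comp_descent_set (lam : seq nat) : seq nat :=
  [seq sumn (take k lam) | k <- iota 1 (size lam).-1].

(* A permutation of {1,...,N} is a sequence s with s_(i-1) = sigma(i),
   i.e. an element of [permutations (iota 1 N)]. *)
Definition perm_val (s : seq nat) (i : nat) : nat := nth 0%N s i.-1.

Definition perm_descents (N : nat) (s : seq nat) : seq nat :=
  [seq i <- iota 1 N.-1 | (perm_val s i.+1 < perm_val s i)%N].

Definition has_descent_set (N : nat) (s : seq nat) (D : seq nat) : bool :=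
  all (fun i => i \in D) (perm_descents N s) &&
  all (fun i => i \in perm_descents N s) D.

Definition perms_with_descents (N : nat) (lam : seq nat) : seq (seq nat) :=
  [seq s <- permutations (iota 1 N) | has_descent_set N s (comp_descent_set lam)].

(* a finitely supported measure: a list of (weight, atom) *)
Definition fmeas (T : Type) := seq (R * T).

Definition indicator (P : Prop) : R :=
  if excluded_middle_informative P then 1 else 0.

Definition fm_eval (T : Type) (m : fmeas T) (A : T -> Prop) : R :=
  foldr (fun p acc => p.1 * indicator (A p.2) + acc) 0 m.

Definition unif_law (Omega T : Type) (Om : seq Omega) (f : Omega -> T) : fmeas T :=
  [seq (/ INR (size Om), f w) | w <- Om].

(* product measure mu_1 (x) ... (x) mu_r of measures on R, as a measure on R^r
   (points of R^r represented as sequences of length r) *)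
Fixpoint fm_prod (ms : seq (fmeas R)) : fmeas (seq R) :=
  match ms with
  | [::] => [:: (1, [::])]
  | m :: ms' => [seq (p.1 * q.1, p.2 :: q.2) | p <- m, q <- fm_prod ms']
  end.

Definition euclid_dist (x y : seq R) : R :=
  sqrt (foldr (fun p acc => (p.1 - p.2) ^ 2 + acc) 0 (zip x y)).

Definition nbhd (A : seq R -> Prop) (e : R) : seq R -> Prop :=
  fun x => exists y, A y /\ euclid_dist x y < e.

Definition LP_cond (mu nu : fmeas (seq R)) (e : R) : Prop :=
  forall A : seq R -> Prop,
    fm_eval mu A <= fm_eval nu (nbhd A e) + e /\
    fm_eval nu A <= fm_eval mu (nbhd A e) + e.

Definition is_inf (E : R -> Prop) (m : R) : Prop :=
  (forall x, E x -> m <= x) /\ (forall b, (forall x, E x -> b <= x) -> b <= m).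

Definition levy_prokhorov (mu nu : fmeas (seq R)) : R :=
  epsilon (inhabits 0) (is_inf (fun e => 0 < e /\ LP_cond mu nu e)).

Definition scaled_vec (N : nat) (i : nat -> nat) (r : nat) (s : seq nat) : seq R :=
  [seq INR (perm_val s (i j)) / INR N | j <- iota 0 r].

Definition joint_law (N : nat) (lam : seq nat) (i : nat -> nat) (r : nat) : fmeas (seq R) :=
  unif_law (perms_with_descents N lam) (scaled_vec N i r).

Definition marginal_law (N : nat) (lam : seq nat) (k : nat) : fmeas R :=
  unif_law (perms_with_descents N lam) (fun s => INR (perm_val s k) / INR N).

Definition prod_marginals (N : nat) (lam : seq nat) (i : nat -> nat) (r : nat) : fmeas (seq R) :=
  fm_prod [seq marginal_law N lam (i j) | j <- iota 0 r].

(* Main.v *)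
(** Replace the random permutation by a uniform word w_0 ... w_{N-1} with letters in {0, ..., M-1}
    that weakly increases at the ascents and weakly decreases at the descents, with M much larger
    than N.  The coordinates of such a word form a Markov chain.  The number h(x) of continuations
    of a word from the letter x is log-concave, hence its hazard rate is monotone, and conditional
    expectation along the chain maps functions with slopes in [0, 1] to functions with slopes in
    [0, 1].  Consequently Cov(w_a, w_b) is nonnegative and nonincreasing in b >= a.

    For words with distinct letters, the sum S of all letters depends only on the set of letters,
    which is independent of the permutation sigma that orders them; since w_a is the letter of rank
    sigma(a), Cov(w_a, S) averages the covariances of the order statistics with S and is O(M^2).
    As the n covariances Cov(w_a, w_c), a < c <= a + n, are at least Cov(w_a, w_b) for b >= a + n
    and all others are nonnegative, Cov(w_a, w_b) = O(M^2 / n).  By the Markov property, the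
    conditional mean of g(w_b) given the past is then almost constant for every Lipschitz g, which
    factorizes the joint law asymptotically on products of Lipschitz functions.

    Words with distinct letters dominate when M is large; their moments are computed exactly by
    inserting unused values one at a time, and w_a / M is within O(N^(-1/2)) of sigma(a) / N.  A
    partition of unity of the cube into products of tent functions turns the factorization into a
    bound on the Levy-Prokhorov distance. *)

Require Import Defs.
From Stdlib Require Import Reals ClassicalEpsilon.
From mathcomp Require Import all_boot all_order all_algebra.
From mathcomp Require Import zify ring lra.
From mathcomp Require Import Rstruct.

Set Implicit Arguments.
Unset Strict Implicit.
Unset Printing Implicit Defensive.
Import Order.TTheory GRing.Theory Num.Theory.
Local Open Scope ring_scope.

(** * One step of the chain *)

Section OneStep.
Variables (F : realFieldType) (M : nat).
Implicit Types (f g h : nat -> F) (x y z : nat) (d : bool).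

Definition ndecr f := forall x, (x.+1 < M)%N -> f x <= f x.+1.

(** An upper bound 1 on the slopes, phrased as monotonicity so that the lemmas on [ndecr] apply to
    it too. *)
Definition slope1 f := ndecr (fun x => x%:R - f x).

(** The second clause is the division-free form of: [h x.+1 / h x] is nonincreasing. *)
Definition log_concave h :=
  (forall x, (x < M)%N -> 0 < h x) /\
  (forall x z, (x <= z)%N -> (z.+1 < M)%N -> h x * h z.+1 <= h x.+1 * h z).

(* [d = true] encodes a descent, also in lists [ds] of consecutive steps. *)
Definition nexts d x : seq nat :=
  if d then index_iota 0 x.+1 else index_iota x M.

Definition step_sum d h x : F := \sum_(y <- nexts d x) h y.

(** The Doob transform of a uniform step: when [h] counts continuations, this is the conditional
    expectation of [f] at the next letter given the current letter [x]. *)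
Definition step_avg d h f x : F := step_sum d (fun y => h y * f y) x / step_sum d h x.

Lemma ndecr_le f x y : ndecr f -> (x <= y)%N -> (y < M)%N -> f x <= f y.
Proof.
move=> nf; elim: y => [|y IH]; first by rewrite leqn0 => /eqP->.
rewrite leq_eqVlt => /orP[/eqP->//|lxy] ltM.
by apply: le_trans (nf _ ltM); apply: IH => //; apply: ltnW.
Qed.

Lemma step_sum_asc h x : (x < M)%N -> step_sum false h x = h x + step_sum false h x.+1.
Proof. by move=> ltxM; rewrite /step_sum /nexts big_ltn. Qed.

Lemma step_sum_gt0 d h x : (x < M)%N ->
  (forall y, (y < M)%N -> 0 < h y) -> 0 < step_sum d h x.
Proof.
move=> xM hp; rewrite /step_sum /nexts; case: d.
  rewrite big_nat_recr //=; apply: ltr_wpDl (hp _ xM).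
  by rewrite big_nat; apply: sumr_ge0 => y yx; apply/ltW/hp; lia.
rewrite big_ltn //; apply: ltr_wpDr (hp _ xM).
by rewrite big_nat; apply: sumr_ge0 => y yx; apply/ltW/hp; lia.
Qed.

(** Induction on [t]: multiply the case [t] by the unit-step inequality at [x + t <= z + t] and
    cancel the common factor [h (x + t) * h (z + t)]. *)
Lemma log_concave4 h x z t : log_concave h -> (x <= z)%N -> (z + t < M)%N ->
  h x * h (z + t)%N <= h z * h (x + t)%N.
Proof.
move=> [hp hc] xz; elim: t => [|t IH]; first by rewrite !addn0 mulrC.
rewrite addnS => ltM; have := IH (ltnW ltM) => {}IH.
have := hc (x + t)%N (z + t)%N; rewrite leq_add2r => /(_ xz ltM) H.
have p1 : 0 < h (x + t)%N by apply: hp; lia.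
have p2 : 0 < h (z + t)%N by apply: hp; lia.
have p3 : 0 < h (z + t).+1 by apply: hp; lia.
have p4 : 0 < h z by apply: hp; lia.
rewrite -(ler_pM2r (mulr_gt0 p1 p2)) addnS.
apply: le_trans (_ : (h z * h (x + t)%N) * (h (x + t)%N * h (z + t).+1) <= _).
  rewrite [leLHS](_ : _ = (h x * h (z + t)%N) * (h (x + t)%N * h (z + t).+1)); last by ring.
  by apply: ler_wpM2r => //; apply: mulr_ge0; apply: ltW.
rewrite [leRHS](_ : _ = (h z * h (x + t)%N) * (h (x + t).+1 * h (z + t)%N)); last by ring.
by apply: ler_wpM2l => //; apply: mulr_ge0; apply: ltW.
Qed.

(** Monotone hazard rate, cleared of denominators. The tails are compared term by term at equal
    distance from [x] and [z]; any extra terms beyond [x] are positive. *)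
Lemma hazard_le h x z : log_concave h -> (x <= z)%N -> (z < M)%N ->
  h x * step_sum false h z.+1 <= h z * step_sum false h x.+1.
Proof.
move=> lc xz zM; rewrite /step_sum /nexts.
rewrite (big_addn 0 M z.+1) (big_addn 0 M x.+1) !big_mkord.
rewrite (big_ord_widen (M - x.+1) (fun i => h (i + z.+1)%N)); last by lia.
rewrite !mulr_sumr big_mkcond /=; apply: ler_sum => t _.
have [hp _] := lc.
case: ifP => tz.
  have := @log_concave4 h x z t.+1 lc xz.
  rewrite !addnS addnC [(x + t)%N]addnC; apply.
  by have := ltn_ord t; lia.
by apply: mulr_ge0; apply/ltW/hp; have := ltn_ord t; lia.
Qed.

(** Moving from [x] to [x + 1] removes the atom [x] from the averaging range, so the increment is
    the probability of that atom times the mean excess over [f x] on the remaining letters. *)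
Lemma sub_step_avg_asc h f x : (x.+1 < M)%N -> (forall y, (y < M)%N -> 0 < h y) ->
  step_avg false h f x.+1 - step_avg false h f x =
  h x * step_sum false (fun y => h y * (f y - f x)) x.+1 /
  (step_sum false h x * step_sum false h x.+1).
Proof.
move=> xM hp; rewrite /step_avg.
have e1 := step_sum_asc h (ltnW xM).
have e2 := step_sum_asc (fun y => h y * f y) (ltnW xM).
have p1 := step_sum_gt0 false (ltnW xM) hp; have p2 := step_sum_gt0 false xM hp.
have e3 : step_sum false (fun y => h y * (f y - f x)) x.+1 =
  step_sum false (fun y => h y * f y) x.+1 - step_sum false h x.+1 * f x.
  rewrite /step_sum mulr_suml -sumrB; apply: eq_bigr => y _; ring.
rewrite e3 e2; move: p1; rewrite e1 => p1.
field; by rewrite !gt_eqF.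
Qed.

Lemma ndecr_avg_asc h f : (forall y, (y < M)%N -> 0 < h y) -> ndecr f ->
  ndecr (step_avg false h f).
Proof.
move=> hp nf x xM; rewrite -subr_ge0 sub_step_avg_asc //.
apply: divr_ge0; last first.
  by apply: mulr_ge0; apply/ltW/step_sum_gt0 => //; apply: ltnW.
apply: mulr_ge0; first by apply/ltW/hp/ltnW.
rewrite /step_sum /nexts big_nat; apply: sumr_ge0 => y /andP[xy yM].
by apply: mulr_ge0; [apply/ltW/hp | rewrite subr_ge0; apply: ndecr_le => //; apply: ltnW].
Qed.

(** Summation by parts: the increment of [f] from [z] to [z + 1] is at most 1 and is weighted by the
    tail of [h] beyond [z]. *)
Lemma sum_increments_le h f x : (x < M)%N -> (forall y, (y < M)%N -> 0 < h y) ->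
  slope1 f ->
  step_sum false (fun y => h y * (f y - f x)) x.+1 <=
  \sum_(x <= z < M) step_sum false h z.+1.
Proof.
move=> xM hp sf; have [n nE] := ubnP (M - x)%N.
elim: n x nE xM => // n IH x nE xM.
rewrite big_ltn //; have [Mx|xM'] := leqP M x.+1.
  by rewrite big_geq // /step_sum /nexts !big_geq ?addr0.
apply: le_trans (lerD (lexx _) (IH x.+1 _ xM')); last by lia.
have -> : step_sum false (fun y => h y * (f y - f x)) x.+1 =
  step_sum false h x.+1 * (f x.+1 - f x) +
  step_sum false (fun y => h y * (f y - f x.+1)) x.+2.
  rewrite step_sum_asc // [X in _ = X * _ + _]step_sum_asc // mulrDl -addrA; congr (_ + _).
  rewrite /step_sum mulr_suml -big_split /=; apply: eq_bigr => y _; ring.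
rewrite lerD2r -[leRHS]mulr1; apply: ler_wpM2l.
  by apply/ltW/step_sum_gt0.
by have := sf x xM'; rewrite -natr1; lra.
Qed.

Lemma slope1_avg_asc h f : log_concave h -> ndecr f -> slope1 f ->
  slope1 (step_avg false h f).
Proof.
move=> lc nf sf x xM; have [hp hc] := lc.
have p1 := step_sum_gt0 false (ltnW xM) hp; have p2 := step_sum_gt0 false xM hp.
suff : step_avg false h f x.+1 - step_avg false h f x <= 1 by rewrite -natr1; lra.
rewrite sub_step_avg_asc // ler_pdivrMr ?mul1r; last exact: mulr_gt0.
(* By [hazard_le], [h x] times the tail beyond [z] is at most [h z] times the tail beyond [x];
   summing over [z >= x] gives exactly the product of the two step sums. *)
apply: le_trans (_ : h x * \sum_(x <= z < M) step_sum false h z.+1 <= _); last first.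
  rewrite mulrC mulr_suml.
  apply: le_trans (_ : \sum_(x <= z < M) h z * step_sum false h x.+1 <= _).
    rewrite [leLHS]big_nat [leRHS]big_nat; apply: ler_sum => z /andP[xz zM].
    by rewrite mulrC; apply: hazard_le.
  by rewrite -mulr_suml.
apply: ler_wpM2l; first by apply/ltW/hp/ltnW.
exact: sum_increments_le (ltnW xM) hp sf.
Qed.

(** * Reflection of the alphabet: descents from ascents *)

Definition mirror f x : F := f (M - x.+1)%N.

Lemma step_sum_mirror h x : (x < M)%N ->
  step_sum true h x = step_sum false (mirror h) (M - x.+1)%N.
Proof.
move=> xM; rewrite /step_sum /nexts big_nat_rev /= add0n big_nat.
rewrite (big_addn 0 M (M - x.+1)%N) [RHS]big_nat.
rewrite (_ : (M - (M - x.+1) = x.+1)%N); last by lia.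
by apply: eq_bigr => y yx; rewrite /mirror; congr h; lia.
Qed.

Lemma mirror_log_concave h : log_concave h -> log_concave (mirror h).
Proof.
move=> [hp hc]; split=> [x xM|x z xz zM]; first by apply: hp; lia.
rewrite /mirror; have := hc (M - z.+2)%N (M - x.+2)%N.
rewrite !(_ : forall k, (k.+1 < M)%N -> ((M - k.+2).+1 = M - k.+1)%N); try lia.
by move=> H; rewrite mulrC [leRHS]mulrC; apply: H; lia.
Qed.

(** Reflection reverses monotonicity and the minus sign restores it, here and in the slope bound
    that follows. *)
Lemma mirror_ndecr f : ndecr f -> ndecr (fun x => - mirror f x).
Proof.
move=> nf x xM; rewrite /mirror lerN2.
rewrite -[(M - x.+1)%N](_ : ((M - x.+2).+1 = _)%N); last by lia.
by apply: nf; lia.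
Qed.

Lemma mirror_slope1 f : slope1 f -> slope1 (fun x => - mirror f x).
Proof.
move=> sf x xM; rewrite /mirror.
have := sf (M - x.+2)%N; rewrite (_ : (M - x.+2).+1 = M - x.+1)%N; last by lia.
have -> : (M - x.+1)%N%:R = 1 + (M - x.+2)%N%:R :> F.
  by rewrite -mulrS; congr (_ *+ _); lia.
rewrite -[x.+1%:R]natr1; move=> H; have := H ltac:(lia); lra.
Qed.

Lemma step_avg_mirror h f x : (x < M)%N ->
  step_avg true h f x =
  - mirror (step_avg false (mirror h) (fun y => - mirror f y)) x.
Proof.
move=> xM; rewrite /step_avg !step_sum_mirror // /mirror -mulNr; congr (_ / _).
by rewrite /step_sum -sumrN; apply: eq_bigr => y _; rewrite mulrN opprK.
Qed.

Lemma ndecr_ext f g : (forall x, (x < M)%N -> f x = g x) -> ndecr f -> ndecr g.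
Proof. by move=> e nf x xM; rewrite -!e //; [apply: nf | apply: ltnW]. Qed.

Lemma ndecr_avg d h f : (forall y, (y < M)%N -> 0 < h y) -> ndecr f ->
  ndecr (step_avg d h f).
Proof.
case: d => hp nf; last exact: ndecr_avg_asc.
apply: ndecr_ext (fun x xM => esym (step_avg_mirror h f xM)) _.
apply/mirror_ndecr/ndecr_avg_asc; last exact: mirror_ndecr.
by move=> y yM; apply: hp; lia.
Qed.

Lemma slope1_avg d h f : log_concave h -> ndecr f -> slope1 f ->
  slope1 (step_avg d h f).
Proof.
case: d => lc nf sf; last exact: slope1_avg_asc.
have e x : (x < M)%N -> x%:R - - mirror (step_avg false (mirror h)
    (fun y => - mirror f y)) x = x%:R - step_avg true h f x.
  by move=> xM; rewrite step_avg_mirror.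
apply: ndecr_ext e _; apply/mirror_slope1/slope1_avg_asc.
- exact: mirror_log_concave.
- exact: mirror_ndecr.
- exact: mirror_slope1.
Qed.

(** After splitting off the first terms [h x] and [h z] of the sums, the claim is the hazard
    inequality. *)
Lemma log_concave_step_asc h : log_concave h -> log_concave (step_sum false h).
Proof.
move=> lc; have [hp _] := lc; split=> [x xM|x z xz zM].
  exact: step_sum_gt0.
have xM : (x < M)%N by lia.
rewrite (step_sum_asc h xM) (step_sum_asc h (ltnW zM)).
have := @hazard_le h x z lc xz (ltnW zM).
set a := step_sum _ _ _; set b := step_sum _ _ _; lra.
Qed.

Lemma log_concave_ext f g :
  (forall x, (x < M)%N -> f x = g x) -> log_concave f -> log_concave g.
Proof.
move=> e [fp fc]; split=> [x xM|x z xz zM]; first by rewrite -e //; apply: fp.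
by rewrite -!e //; try lia; apply: fc.
Qed.

Lemma log_concave_step d h : log_concave h -> log_concave (step_sum d h).
Proof.
case: d => lc; last exact: log_concave_step_asc.
apply: log_concave_ext (fun x xM => esym (step_sum_mirror h xM)) _.
exact/mirror_log_concave/log_concave_step_asc/mirror_log_concave.
Qed.

End OneStep.

(** * Means and covariances over a list *)

Section UniformMean.
Variables (F : realFieldType) (T : eqType).
Implicit Types (Om : seq T) (u v : T -> F) (c : F).

(** Over the empty list this is 0, because inversion sends 0 to 0. *)
Definition mean Om u : F := (\sum_(w <- Om) u w) / (size Om)%:R.

Definition cov Om u v : F := mean Om (fun w => u w * v w) - mean Om u * mean Om v.

Lemma eq_mean Om u v : {in Om, u =1 v} -> mean Om u = mean Om v.
Proof. by move=> e; rewrite /mean (eq_big_seq v). Qed.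

Lemma meanD Om u v : mean Om (fun w => u w + v w) = mean Om u + mean Om v.
Proof. by rewrite /mean big_split mulrDl. Qed.

Lemma meanN Om u : mean Om (fun w => - u w) = - mean Om u.
Proof. by rewrite /mean sumrN mulNr. Qed.

Lemma meanB Om u v : mean Om (fun w => u w - v w) = mean Om u - mean Om v.
Proof. by rewrite meanD meanN. Qed.

Lemma meanZ Om c u : mean Om (fun w => c * u w) = c * mean Om u.
Proof. by rewrite /mean -mulr_sumr mulrA. Qed.

Lemma mean_sum (I : Type) (r : seq I) Om (u : I -> T -> F) :
  mean Om (fun w => \sum_(i <- r) u i w) = \sum_(i <- r) mean Om (u i).
Proof. by rewrite /mean exchange_big mulr_suml. Qed.

Lemma mean_const Om c : Om != [::] -> mean Om (fun _ => c) = c.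
Proof.
move=> nOm; rewrite /mean big_const_seq count_predT iter_addr_0 -[c *+ _]mulr_natr mulfK //.
by rewrite pnatr_eq0 size_eq0.
Qed.

Lemma mean_nil u : mean [::] u = 0.
Proof. by rewrite /mean big_nil mul0r. Qed.

Lemma ler_mean Om u v : {in Om, forall w, u w <= v w} -> mean Om u <= mean Om v.
Proof.
move=> le; rewrite /mean ler_wpM2r ?invr_ge0 ?ler0n //.
by rewrite big_seq [leRHS]big_seq; apply: ler_sum.
Qed.

Lemma mean_le_const Om u c : 0 <= c -> {in Om, forall w, u w <= c} -> mean Om u <= c.
Proof.
case: (eqVneq Om [::]) => [-> c0 _|nOm _ le]; first by rewrite mean_nil.
by rewrite -(mean_const c nOm); apply: ler_mean.
Qed.

Lemma ler_norm_mean Om u : `|mean Om u| <= mean Om (fun w => `|u w|).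
Proof.
rewrite /mean normrM [X in _ * X]ger0_norm ?invr_ge0 ?ler0n //.
by rewrite ler_wpM2r ?invr_ge0 ?ler0n // ler_norm_sum.
Qed.

Lemma norm_meanB_le Om u v : `|mean Om u - mean Om v| <= mean Om (fun w => `|u w - v w|).
Proof. by rewrite -meanB ler_norm_mean. Qed.

(** Symmetrization with an independent copy; it reduces comparisons of covariances to comparisons
    over pairs of points, as in [cov_le]. *)
Lemma covE Om u v : 2 * ((size Om)%:R ^+ 2 * cov Om u v) =
  \sum_(s <- Om) \sum_(t <- Om) (u s - u t) * (v s - v t).
Proof.
case: (eqVneq Om [::]) => [->|nOm]; first by rewrite big_nil expr0n mul0r mulr0.
have n0 : (size Om)%:R != 0 :> F by rewrite pnatr_eq0 size_eq0.
transitivity (\sum_(s <- Om) ((size Om)%:R * (u s * v s) - u s * (\sum_(t <- Om) v t)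
   - (\sum_(t <- Om) u t) * v s + \sum_(t <- Om) u t * v t)).
  rewrite big_split /= big_const_seq count_predT iter_addr_0 !sumrB.
  rewrite -mulr_suml -mulr_sumr -mulr_sumr -mulr_natl /cov /mean; field; exact: n0.
apply: eq_bigr => s _.
transitivity (\sum_(t <- Om) (u s * v s - u s * v t - u t * v s + u t * v t)).
  rewrite big_split /= !sumrB big_const_seq count_predT iter_addr_0.
  by rewrite -mulr_suml -mulr_sumr [in LHS]mulr_natl.
apply: eq_bigr => t _; ring.
Qed.

Lemma cov_le Om u v u' v' :
  {in Om &, forall s t, (u s - u t) * (v s - v t) <= (u' s - u' t) * (v' s - v' t)} ->
  cov Om u v <= cov Om u' v'.
Proof.
case: (eqVneq Om [::]) => [->|nOm le]; first by rewrite /cov !mean_nil.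
have n0 : 0 < (size Om)%:R ^+ 2 :> F by rewrite exprn_gt0 // ltr0n lt0n size_eq0.
rewrite -(ler_pM2l n0) -(@ler_pM2l _ 2) // !covE.
rewrite big_seq [leRHS]big_seq; apply: ler_sum => s sOm.
rewrite big_seq [leRHS]big_seq; apply: ler_sum => t tOm.
exact: le.
Qed.

Lemma covZ Om c u v : cov Om u (fun w => c * v w) = c * cov Om u v.
Proof.
rewrite /cov meanZ -[in LHS](eq_mean (u := fun w => c * (u w * v w))); last first.
  by move=> w _; rewrite mulrCA.
by rewrite meanZ; ring.
Qed.

Lemma covC Om u v : cov Om u v = cov Om v u.
Proof. by rewrite /cov [X in X - _](eq_mean (v := fun w => v w * u w)) 1?mulrC // => w _; rewrite mulrC. Qed.

Lemma cov_ge0 Om u v :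
  {in Om &, forall s t, 0 <= (u s - u t) * (v s - v t)} -> 0 <= cov Om u v.
Proof.
move=> le; have <- : cov Om u (fun _ => 0) = 0.
  rewrite -[RHS](mul0r (cov Om u (fun _ => 0))) -covZ; congr cov.
  by rewrite (_ : (fun _ : T => 0 * 0) = (fun _ => 0)) // mulr0.
by apply: cov_le => s t sOm tOm; rewrite subrr mulr0; apply: le.
Qed.

Lemma cov_sumr (I : Type) (r : seq I) Om u (v : I -> T -> F) :
  cov Om u (fun w => \sum_(i <- r) v i w) = \sum_(i <- r) cov Om u (v i).
Proof.
rewrite /cov sumrB mean_sum mulr_sumr -mean_sum; congr (_ - _).
by apply: eq_mean => w _; rewrite mulr_sumr.
Qed.

(** Average the inequality [|d| <= t + d ^ 2 / t], where [d] is the deviation from the mean. *)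
Lemma mean_norm_center_le Om u (t : F) : Om != [::] -> 0 < t ->
  mean Om (fun w => `|u w - mean Om u|) <= t + cov Om u u / t.
Proof.
move=> nOm t0; set c := mean Om u.
have -> : t + cov Om u u / t = mean Om (fun w => t + t^-1 * (u w - c) ^+ 2).
  rewrite meanD mean_const // meanZ mulrC; congr (_ + _ * _).
  rewrite (eq_mean (v := fun w => (u w * u w - (2 * c) * u w) + c * c)); last first.
    by move=> w _; ring.
  rewrite meanD meanB meanZ mean_const // /cov -/c; ring.
apply: ler_mean => w _; set d := u w - c.
rewrite -(ler_pM2r t0) mulrDl [t^-1 * _]mulrC divfK ?gt_eqF //.
rewrite -[d ^+ 2]real_normK ?num_real //.
have := sqr_ge0 (`|d| - t); have := normr_ge0 d; nra.
Qed.

End UniformMean.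

(** * Weakly monotone words *)

Section WeakWords.
Variables (F : realFieldType) (M : nat).
Implicit Types (ds : seq bool) (x y k : nat) (f g : nat -> F) (c l : F).

Fixpoint words_from ds x : seq (seq nat) :=
  if ds is d :: ds' then
    [seq x :: s | y <- nexts M d x, s <- words_from ds' y]
  else [:: [:: x]].

Definition words ds : seq (seq nat) := [seq s | x <- iota 0 M, s <- words_from ds x].

Definition nwords ds x : F := (size (words_from ds x))%:R.

Lemma sum_words_from d ds x (G : seq nat -> F) :
  \sum_(s <- words_from (d :: ds) x) G s =
  \sum_(y <- nexts M d x) \sum_(s <- words_from ds y) G (x :: s).
Proof. by rewrite /= big_allpairs_dep. Qed.

Lemma sum_words ds (G : seq nat -> F) :
  \sum_(s <- words ds) G s = \sum_(x <- iota 0 M) \sum_(s <- words_from ds x) G s.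
Proof. by rewrite /= big_allpairs_dep. Qed.

Lemma sum1_nwords ds x : nwords ds x = \sum_(s <- words_from ds x) 1.
Proof. by rewrite big_const_seq count_predT iter_addr_0. Qed.

Lemma nwords_cons d ds x : nwords (d :: ds) x = step_sum M d (nwords ds) x.
Proof.
by rewrite sum1_nwords sum_words_from; apply: eq_bigr => y _; rewrite sum1_nwords.
Qed.

(** Words with a single letter are counted by the constant 1; each further letter at the front sums
    the counts over one step, which preserves log-concavity. *)
Lemma nwords_log_concave ds : log_concave M (nwords ds).
Proof.
elim: ds => [|d ds IH].
  have e x : (x < M)%N -> 1 = nwords [::] x by [].
  by apply: log_concave_ext e _; split=> *; rewrite ?ltr01.
have e x : (x < M)%N -> step_sum M d (nwords ds) x = nwords (d :: ds) x.
  by move=> _; rewrite nwords_cons.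
exact: log_concave_ext e (log_concave_step _ IH).
Qed.

Lemma nwords_gt0 ds x : (x < M)%N -> 0 < nwords ds x.
Proof. by have [+ _] := nwords_log_concave ds; apply. Qed.

Lemma nexts_lt d x y : (x < M)%N -> y \in nexts M d x -> (y < M)%N.
Proof. by move=> xM; rewrite /nexts; case: d; rewrite mem_index_iota; lia. Qed.

Lemma words_from_head ds x s : s \in words_from ds x -> exists s', s = x :: s'.
Proof.
case: ds => [|d ds] /=; first by rewrite inE => /eqP->; exists [::].
by case/allpairsPdep => y [s' [_ _ ->]]; exists s'.
Qed.

(** * Conditional means given the first letter *)

Definition cond_mean ds g k x : F :=
  (\sum_(s <- words_from ds x) g (nth 0%N s k)) / nwords ds x.

Lemma cond_mean0 ds g x : (x < M)%N -> cond_mean ds g 0 x = g x.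
Proof.
move=> xM; rewrite /cond_mean (eq_big_seq (fun _ => g x * 1)).
  by rewrite -mulr_sumr -sum1_nwords mulfK // gt_eqF // nwords_gt0.
by move=> s /words_from_head[s' ->]; rewrite mulr1.
Qed.

Lemma cond_mean_cons d ds g k x : (x < M)%N ->
  cond_mean (d :: ds) g k.+1 x = step_avg M d (nwords ds) (cond_mean ds g k) x.
Proof.
move=> xM; rewrite /cond_mean sum_words_from nwords_cons /step_avg; congr (_ / _).
apply: eq_big_seq => y /(nexts_lt xM) yM; rewrite mulrC divfK //.
by rewrite gt_eqF // nwords_gt0.
Qed.

(** Beyond the last letter [nth] returns 0, so the conditional mean is constant there and
    monotonicity in the first letter persists for every [k]. *)
Lemma cond_mean_nil g k x : cond_mean [::] g k.+1 x = g 0%N.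
Proof. by rewrite /cond_mean big_seq1 /nwords /= divr1 nth_nil. Qed.

Lemma cond_meanD ds g1 g2 k x :
  cond_mean ds (fun y => g1 y + g2 y) k x = cond_mean ds g1 k x + cond_mean ds g2 k x.
Proof. by rewrite /cond_mean big_split mulrDl. Qed.

Lemma cond_meanZ ds c g k x :
  cond_mean ds (fun y => c * g y) k x = c * cond_mean ds g k x.
Proof. by rewrite /cond_mean -mulr_sumr mulrA. Qed.

Lemma cond_mean_ndecr ds g k : ndecr M g -> ndecr M (cond_mean ds g k).
Proof.
move=> ng; elim: ds k => [|d ds IH] [|k].
- by apply: ndecr_ext ng => x xM; rewrite cond_mean0.
- by move=> x _; rewrite !cond_mean_nil.
- by apply: ndecr_ext ng => x xM; rewrite cond_mean0.
apply: ndecr_ext (fun x xM => esym (cond_mean_cons d ds g k xM)) _.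
by apply: ndecr_avg => // y yM; apply: nwords_gt0.
Qed.

Let idF (x : nat) : F := x%:R.

Lemma ndecr_id : ndecr M idF.
Proof. by move=> x _; rewrite ler_nat. Qed.

Lemma cond_mean_slope1 ds k : slope1 M (cond_mean ds idF k).
Proof.
elim: ds k => [|d ds IH] [|k].
- have e x : (x < M)%N -> 0 = x%:R - cond_mean [::] idF 0 x.
    by move=> xM; rewrite cond_mean0 // subrr.
  exact: (ndecr_ext e).
- by move=> x _; rewrite !cond_mean_nil lerD2r ler_nat.
- have e x : (x < M)%N -> 0 = x%:R - cond_mean (d :: ds) idF 0 x.
    by move=> xM; rewrite cond_mean0 // subrr.
  exact: (ndecr_ext e).
have e x : (x < M)%N -> x%:R - step_avg M d (nwords ds) (cond_mean ds idF k) x =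
   x%:R - cond_mean (d :: ds) idF k.+1 x by move=> xM; rewrite cond_mean_cons.
apply: ndecr_ext e _; apply: slope1_avg (IH k).
  exact: nwords_log_concave.
exact: cond_mean_ndecr ndecr_id.
Qed.

(** The case [k = 0] is the slope bound, and one-step averaging carries monotonicity to larger [k].
    This is what makes covariances decrease with the distance. *)
Lemma cond_mean_decrement ds k :
  ndecr M (fun x => cond_mean ds idF k x - cond_mean ds idF k.+1 x).
Proof.
elim: k ds => [|k IH] ds.
  have e x : (x < M)%N -> x%:R - cond_mean ds idF 1 x =
     cond_mean ds idF 0 x - cond_mean ds idF 1 x by move=> xM; rewrite cond_mean0.
  exact: ndecr_ext e (cond_mean_slope1 ds 1).
case: ds => [|d ds]; first by move=> x _; rewrite !cond_mean_nil.
have e x : (x < M)%N ->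
   step_avg M d (nwords ds) (fun y => cond_mean ds idF k y - cond_mean ds idF k.+1 y) x =
   cond_mean (d :: ds) idF k.+1 x - cond_mean (d :: ds) idF k.+2 x.
  move=> xM; rewrite !cond_mean_cons // /step_avg -mulrBl; congr (_ / _).
  by rewrite /step_sum -sumrB; apply: eq_bigr => y _; rewrite mulrBr.
by apply: ndecr_ext e _; apply: ndecr_avg (IH ds) => y yM; apply: nwords_gt0.
Qed.

(** The Markov property: given the prefix up to position [a], the rest is a uniform word started at
    the letter in position [a]. *)
Lemma sum_words_from_markov ds a k x (G : seq nat -> F) g : (a <= size ds)%N -> (x < M)%N ->
  \sum_(s <- words_from ds x) G (take a.+1 s) * g (nth 0%N s (a + k)) =
  \sum_(s <- words_from ds x) G (take a.+1 s) * cond_mean (drop a ds) g k (nth 0%N s a).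
Proof.
elim: a ds x G => [|a IH] ds x G; last first.
  case: ds => [//|d ds] /= ad xM; rewrite !sum_words_from.
  apply: eq_big_seq => y /(nexts_lt xM) yM.
  by rewrite /= (IH ds y (fun s => G (x :: s))).
move=> _ xM; rewrite add0n drop0.
transitivity (\sum_(s <- words_from ds x) G [:: x] * g (nth 0%N s k)).
  by apply: eq_big_seq => s /words_from_head[s' ->]; rewrite /= take0.
transitivity (\sum_(s <- words_from ds x) G [:: x] * cond_mean ds g k x * 1); last first.
  by apply: eq_big_seq => s /words_from_head[s' ->]; rewrite /= take0 mulr1.
rewrite -!mulr_sumr -sum1_nwords /cond_mean -mulrA divfK //.
by rewrite gt_eqF // nwords_gt0.
Qed.

Lemma mean_words_markov ds a k (G : seq nat -> F) g : (a <= size ds)%N ->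
  mean (words ds) (fun s => G (take a.+1 s) * g (nth 0%N s (a + k))) =
  mean (words ds) (fun s => G (take a.+1 s) * cond_mean (drop a ds) g k (nth 0%N s a)).
Proof.
move=> ad; rewrite /mean; congr (_ / _); rewrite !sum_words.
apply: eq_big_seq => x; rewrite mem_iota add0n => xM.
exact: sum_words_from_markov.
Qed.

Lemma mem_words_lt ds s i : s \in words ds -> (0 < M)%N -> (nth 0%N s i < M)%N.
Proof.
case/allpairsPdep => x [s' [xM s'W ->]] M0.
rewrite mem_iota add0n in xM; move: xM => /= xM.
elim: ds x s' xM s'W i => [|d ds IH] x s' xM /=.
  by rewrite inE => /eqP-> [|i] //=; rewrite nth_nil.
case/allpairsPdep => y [s'' [yM s''W ->]] [|i] //=.
by apply: IH s''W i; apply: nexts_lt yM.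
Qed.

(** * Covariances of the coordinates of a uniform word *)

Definition coord (i : nat) (w : seq nat) : F := (nth 0%N w i)%:R.

Lemma mean_words_markov1 ds a k g : (a <= size ds)%N ->
  mean (words ds) (fun s => g (nth 0%N s (a + k))) =
  mean (words ds) (fun s => cond_mean (drop a ds) g k (nth 0%N s a)).
Proof.
move=> ad; have := @mean_words_markov ds a k (fun _ => 1) g ad.
rewrite (eq_mean (v := fun s => g (nth 0%N s (a + k)))) => [->|s _]; last by rewrite mul1r.
by apply: eq_mean => s _; rewrite mul1r.
Qed.

Lemma cov_coord_cond ds a k : (a <= size ds)%N ->
  cov (words ds) (coord a) (coord (a + k)) =
  cov (words ds) (coord a) (fun s => cond_mean (drop a ds) idF k (nth 0%N s a)).
Proof.
move=> ad; rewrite /cov /coord (mean_words_markov1 k idF ad); congr (_ - _).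
have := @mean_words_markov ds a k (fun s => (nth 0%N s a)%:R) idF ad.
by under eq_mean do rewrite nth_take //; under [in RHS]eq_mean do rewrite nth_take //.
Qed.

Lemma words_nil_or_gt0 ds : (words ds == [::]) || (0 < M)%N.
Proof. by case: (posnP M) => [M0|_]; rewrite ?orbT // /words (_ : iota 0 M = [::]) // M0. Qed.

Lemma ndecr_comonotone f1 f2 x y : ndecr M f1 -> ndecr M f2 -> (x < M)%N -> (y < M)%N ->
  0 <= (f1 x - f1 y) * (f2 x - f2 y) :> F.
Proof.
move=> n1 n2 xM yM; have [xy|/ltnW yx] := leqP x y.
  by apply: mulr_le0; rewrite subr_le0; [apply: (ndecr_le n1) | apply: (ndecr_le n2)].
by apply: mulr_ge0; rewrite subr_ge0; [apply: (ndecr_le n1) | apply: (ndecr_le n2)].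
Qed.

(** Chebyshev's association inequality: two monotone functions of one letter order every pair of
    words alike. *)
Lemma cov_ndecr_ge0 ds a f1 f2 : ndecr M f1 -> ndecr M f2 ->
  0 <= cov (words ds) (fun s => f1 (nth 0%N s a)) (fun s => f2 (nth 0%N s a)).
Proof.
move=> n1 n2; case/orP: (words_nil_or_gt0 ds) => [/eqP->|M0].
  by rewrite /cov !mean_nil mulr0 subr0.
by apply: cov_ge0 => s t sW tW; apply: ndecr_comonotone => //; apply: mem_words_lt sW _ || apply: mem_words_lt tW _.
Qed.

Lemma cov_coord_ge0 ds a b : (a <= size ds)%N -> (b <= size ds)%N ->
  0 <= cov (words ds) (coord a) (coord b).
Proof.
wlog ab : a b / (a <= b)%N.
  by move=> H; case: (leqP a b) => [|/ltnW] ab aN bN; [|rewrite covC]; apply: H.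
move=> aN _; rewrite -(subnKC ab) cov_coord_cond //.
exact: cov_ndecr_ge0 ndecr_id (cond_mean_ndecr _ _ ndecr_id).
Qed.

(** The difference of the two sides is the covariance of the letter at [a] with the nondecreasing
    function of it from [cond_mean_decrement]. *)
Lemma cov_coord_decr ds a k : (a <= size ds)%N ->
  cov (words ds) (coord a) (coord (a + k.+1)) <= cov (words ds) (coord a) (coord (a + k)).
Proof.
move=> aN; rewrite !cov_coord_cond //; apply: cov_le => s t sW tW.
rewrite -subr_ge0 -mulrBr.
case/orP: (words_nil_or_gt0 ds) => [/eqP W0|M0]; first by rewrite W0 in sW.
have := ndecr_comonotone ndecr_id (cond_mean_decrement (drop a ds) k)
   (mem_words_lt a sW M0) (mem_words_lt a tW M0).
by rewrite /coord /idF; congr (0 <= _ * _); ring.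
Qed.

Lemma cov_coord_gap ds a n b : (a + n <= b)%N -> (b <= size ds)%N ->
  n%:R * cov (words ds) (coord a) (coord b) <=
  cov (words ds) (coord a) (fun s => \sum_(i < (size ds).+1) coord i s).
Proof.
move=> anb bN; have aN : (a <= size ds)%N by lia.
have mono k (l : nat) : (k <= l)%N ->
  cov (words ds) (coord a) (coord (a + l)) <= cov (words ds) (coord a) (coord (a + k)).
  move=> kl; rewrite -(subnKC kl); elim: (l - k)%N => [|m IH]; first by rewrite addn0.
  by apply: le_trans IH; rewrite addnS; apply: cov_coord_decr.
rewrite cov_sumr -(big_mkord xpredT (fun i => cov _ _ (coord i))).
have pos (c : nat) : (c <= size ds)%N -> 0 <= cov (words ds) (coord a) (coord c).
  by move=> cN; apply: cov_coord_ge0.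
(* Each of the coordinates [a + 1, ..., a + n] contributes at least the covariance with [b]; the
   blocks before and after contribute nonnegative amounts. *)
rewrite (@big_cat_nat _ _ _ a.+1) //=.
rewrite (@big_cat_nat _ _ _ (a + n).+1 a.+1) //=; try lia.
apply: ler_wpDl; first by rewrite big_nat; apply: sumr_ge0 => i ia; apply: pos; lia.
apply: ler_wpDr; first by rewrite big_nat; apply: sumr_ge0 => i ia; apply: pos; lia.
have -> : n%:R * cov (words ds) (coord a) (coord b) =
  \sum_(a.+1 <= i < (a + n).+1) cov (words ds) (coord a) (coord b).
  by rewrite sumr_const_nat mulr_natl; congr (_ *+ _); lia.
apply: ler_sum_nat => i ia.
rewrite -(@subnKC a b) -1?(@subnKC a i); try lia.
by apply: mono; lia.
Qed.

(** Both [l * id + g] and [l * id - g] are nondecreasing, hence so are their conditional means. *)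
Lemma cond_mean_lip ds g l k x y :
  (forall z, (z.+1 < M)%N -> `|g z.+1 - g z| <= l) -> (x <= y)%N -> (y < M)%N ->
  `|cond_mean ds g k y - cond_mean ds g k x| <=
  l * (cond_mean ds idF k y - cond_mean ds idF k x).
Proof.
move=> gl xy yM.
have n1 : ndecr M (fun z => l * idF z + g z).
  move=> z zM; have := gl z zM; rewrite /idF -natr1 mulrDr mulr1 ler_norml.
  by move=> /andP[]; lra.
have n2 : ndecr M (fun z => l * idF z + -1 * g z).
  move=> z zM; have := gl z zM; rewrite /idF -natr1 mulrDr mulr1 ler_norml.
  by move=> /andP[]; lra.
have := ndecr_le (cond_mean_ndecr ds k n1) xy yM.
have := ndecr_le (cond_mean_ndecr ds k n2) xy yM.
by rewrite !cond_meanD !cond_meanZ ler_norml => H1 H2; apply/andP; split; lra.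
Qed.

(* Conditionally on the prefix, g(w_b) has mean psi(w_a), and |psi(x) - psi(y)| is at most
   l |tau(x) - tau(y)| with tau the conditional mean of w_b itself, so that
   Var psi(w_a) <= l^2 Cov(w_a, tau(w_a)) = l^2 Cov(w_a, w_b). *)
Lemma mean_words_peel ds a b (G : seq nat -> F) g l (t : F) :
  (a <= b)%N -> (b <= size ds)%N -> 0 < t -> 0 <= l ->
  (forall z, (z.+1 < M)%N -> `|g z.+1 - g z| <= l) ->
  {in words ds, forall w, `|G (take a.+1 w)| <= 1} ->
  `|cov (words ds) (fun w => G (take a.+1 w)) (fun w => g (nth 0%N w b))| <=
  t + l ^+ 2 * cov (words ds) (coord a) (coord b) / t.
Proof.
move=> ab bN t0 l0 gl G1; have aN := leq_trans ab bN.
have [W0|nW] := eqVneq (words ds) [::].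
  by rewrite W0 /cov !mean_nil mulr0 subr0 normr0 mulr0 mul0r addr0 ltW.
have M0 : (0 < M)%N by case/orP: (words_nil_or_gt0 ds) nW => // /eqP->.
rewrite -(subnKC ab); set k := (b - a)%N.
set psi := fun s => cond_mean (drop a ds) g k (nth 0%N s a).
(* By the Markov property [g] is replaced by its conditional mean [psi], which is then centred. *)
have -> : cov (words ds) (fun w => G (take a.+1 w)) (fun w => g (nth 0%N w (a + k))) =
  mean (words ds) (fun w => G (take a.+1 w) * (psi w - mean (words ds) psi)).
  rewrite /cov mean_words_markov // mean_words_markov1 // -/psi.
  under [RHS]eq_mean do rewrite mulrBr [X in _ - X]mulrC.
  by rewrite meanB meanZ [in RHS]mulrC.
apply: le_trans (ler_norm_mean _ _) _.
apply: le_trans (_ : mean (words ds) (fun w => `|psi w - mean (words ds) psi|) <= _).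
  apply: ler_mean => w wW; rewrite normrM -[leRHS]mul1r ler_wpM2r //.
  exact: G1.
apply: le_trans (mean_norm_center_le psi nW t0) _.
rewrite lerD2l ler_pM2r ?invr_gt0 // cov_coord_cond // -covZ.
apply: cov_le => s s' sW s'W; rewrite /coord /psi.
have := mem_words_lt a sW M0; have := mem_words_lt a s'W M0.
move: (nth 0%N s a) (nth 0%N s' a) => x y yM xM.
wlog yx : x y yM xM / (y <= x)%N.
  move=> H; case: (leqP y x) => [|/ltnW] yx; first exact: H.
  have {}H := H y x xM yM yx; apply: le_trans (le_trans _ H) _;
    by rewrite le_eqVlt; apply/orP; left; apply/eqP; ring.
have lip := cond_mean_lip (drop a ds) k gl yx xM.
have nt := ndecr_le (cond_mean_ndecr (drop a ds) k ndecr_id) yx xM.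
have s1 := ndecr_le (cond_mean_slope1 (drop a ds) k) yx xM.
move: lip nt s1; set p := cond_mean _ g k x - _; rewrite -!mulrBr.
set u := cond_mean _ _ _ x; set v := cond_mean _ _ _ y => lip nt s1.
rewrite -expr2 -real_normK ?num_real //.
apply: le_trans (_ : (l * (u - v)) ^+ 2 <= _); first by apply: lerXn2r; rewrite ?nnegrE // (le_trans _ lip).
rewrite exprMn [leRHS]mulrCA; apply: ler_wpM2l; first exact: sqr_ge0.
(* The slope bound gives [u - v <= x - y], and [u - v] is nonnegative. *)
rewrite expr2; apply: ler_wpM2r; lra.
Qed.

End WeakWords.

(** * Words with distinct letters *)

Fixpoint fits (ds : seq bool) (w : seq nat) : bool :=
  match ds, w with
  | [::], [:: _] => true
  | d :: ds', x :: (y :: _) as w' => (if d then y <= x else x <= y)%N && fits ds' w'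
  | _, _ => false
  end.

Lemma fits_size ds w : fits ds w -> size w = (size ds).+1.
Proof.
elim: ds w => [|d ds IH] [|x [|y w]] //= /andP[_ /IH /= ->]; by [].
Qed.

Lemma fits_map (f : nat -> nat) ds w :
  (forall x y, (f x <= f y)%N = (x <= y)%N) -> fits ds (map f w) = fits ds w.
Proof.
move=> fm; elim: ds w => [|d ds IH] [|x [|y w]] //=.
by have := IH (y :: w) => /= ->; rewrite !fm.
Qed.

Lemma mem_words_from M ds x s : (x < M)%N ->
  (s \in words_from M ds x) = [&& fits ds s, all (fun v => v < M)%N s & head M s == x].
Proof.
elim: ds x s => [|d ds IH] x s xM /=.
  rewrite inE; case: s => [|y [|z s]] //=; last by rewrite eqseq_cons andbF.
  rewrite eqseq_cons eqxx !andbT; case: eqP => [->|]; rewrite ?xM ?andbF //.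
apply/allpairsPdep/idP => [[y [s' [yx s'W ->]]]|].
  have yM := nexts_lt xM yx; move: s'W; rewrite IH //.
  case: s' => [|z s'] //=; first by case: (ds).
  case/and3P => fz /andP[-> ->] /eqP zy; rewrite xM eqxx fz zy !andbT /=.
  by move: yx; rewrite /nexts; case: (d); rewrite mem_index_iota // => /andP[].
case: s => [|z [|y s]] //=.
case/and3P => /andP[dzy fy] /and3P[zM yM sM] /eqP zx; subst z.
exists y, (y :: s); split=> //; last by rewrite IH //= fy yM sM eqxx.
by rewrite /nexts; case: (d) dzy => dzy; rewrite mem_index_iota ?ltnS dzy ?yM.
Qed.

Lemma mem_words M ds w : (w \in words M ds) = fits ds w && all (fun v => v < M)%N w.
Proof.
apply/allpairsPdep/idP => [[x [s [xM sW ->]]]|/andP[fw wM]].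
  by move: xM; rewrite mem_iota => xM; move: sW; rewrite mem_words_from // => /and3P[-> ->].
have hM : (head M w < M)%N by case: w wM fw => [|y w] //=; [case: (ds) | move=> /andP[->]].
exists (head M w), w; split=> //; first by rewrite mem_iota.
by rewrite mem_words_from // fw wM eqxx.
Qed.

Lemma words_from_uniq M ds x : (x < M)%N -> uniq (words_from M ds x).
Proof.
elim: ds x => [|d ds IH] x xM //=.
apply: allpairs_uniq_dep.
- by rewrite /nexts; case: (d); apply: iota_uniq.
- by move=> y /(nexts_lt xM) yM; apply: IH.
move=> _ _ /allpairsPdep[y [s [yx sW ->]]] /allpairsPdep[y' [s' [y'x s'W ->]]] /=.
by case=> e; move: sW s'W; rewrite -e => /words_from_head[t ->] /words_from_head[t' [-> _]].
Qed.

Lemma words_uniq M ds : uniq (words M ds).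
Proof.
apply: allpairs_uniq_dep; first exact: iota_uniq.
  by move=> y; rewrite mem_iota => yM; apply: words_from_uniq.
move=> _ _ /allpairsPdep[y [s [yx sW ->]]] /allpairsPdep[y' [s' [y'x s'W ->]]] /= e.
by move: sW s'W; rewrite -e => /words_from_head[t ->] /words_from_head[t' [-> _]].
Qed.

Definition inj_words M ds := [seq w <- words M ds | uniq w].

Lemma mem_inj_words M ds w :
  (w \in inj_words M ds) = [&& uniq w, fits ds w & all (fun v => v < M)%N w].
Proof. by rewrite mem_filter mem_words. Qed.

(** [bump m] is the order embedding that leaves a gap at [m]; it preserves patterns and
    distinctness, and [unbump m] inverts it on words that avoid [m]. *)
Lemma inj_words_skip M ds m : (m <= M)%N ->
  perm_eq [seq w <- inj_words M.+1 ds | m \notin w]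
          [seq map (bump m) w | w <- inj_words M ds].
Proof.
move=> mM; apply: uniq_perm.
- by rewrite !filter_uniq // words_uniq.
- rewrite map_inj_uniq; first by rewrite filter_uniq // words_uniq.
  exact/inj_map/(can_inj (bumpK m)).
move=> w; rewrite mem_filter mem_inj_words; apply/idP/mapP.
  case/and4P => mw uw fw wM.
  have e : map (bump m) (map (unbump m) w) = w.
    rewrite -map_comp -[RHS]map_id; apply/eq_in_map => v vw /=.
    by apply: unbumpK; rewrite inE; apply: contraNneq mw => <-.
  exists (map (unbump m) w) => //; rewrite mem_inj_words.
  rewrite -(fits_map ds (map (unbump m) w) (f := bump m)) ?e => [|x y]; last exact: leq_bump2.
  rewrite fw /= -(map_inj_uniq (can_inj (bumpK m))) e uw /= all_map.
  apply/allP => v vw /=; have := allP wM v vw; have : v != m by apply: contraNneq mw => <-.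
  rewrite /unbump; case: (ltnP m v) => /=; lia.
case=> w' + ->; rewrite mem_inj_words => /and3P[uw fw wM].
apply/and4P; split.
- by apply/mapP => -[v _ /eqP]; rewrite (negbTE (neq_bump _ _)).
- by rewrite map_inj_uniq //; apply: can_inj (bumpK m).
- by rewrite fits_map // => x y; apply: leq_bump2.
rewrite all_map; apply/allP => v vw /=; have := allP wM v vw; rewrite /bump; case: leqP => /=; lia.
Qed.

Section Insertion.
Variables (F : realFieldType) (ds : seq bool).
Let N := (size ds).+1.
Implicit Types (M m : nat) (w : seq nat) (f : seq nat -> F).

Lemma count_notin M w : uniq w -> all (fun v => v < M)%N w ->
  count (fun m => m \notin w) (iota 0 M) = (M - size w)%N.
Proof.
move=> uw wM; rewrite -[X in (X - _)%N](size_iota 0) -(count_predC (mem w) (iota 0 M)).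
suff -> : count (mem w) (iota 0 M) = size w by rewrite addKn.
rewrite -size_filter; apply/perm_size/uniq_perm => //; first by rewrite filter_uniq // iota_uniq.
move=> v; rewrite mem_filter mem_iota /= add0n; case vw: (v \in w) => //=.
by have := allP wM v vw.
Qed.

(** Double counting of pairs formed by a word over [M + 1] letters and a letter that it omits: each
    word omits [M + 1 - N] of them. *)
Lemma sum_inj_insert M f :
  \sum_(w <- inj_words M ds) \sum_(m <- iota 0 M.+1) f (map (bump m) w) =
  (M.+1 - N)%:R * \sum_(w <- inj_words M.+1 ds) f w.
Proof.
rewrite exchange_big mulr_sumr.
transitivity (\sum_(m <- iota 0 M.+1) \sum_(w <- inj_words M.+1 ds | m \notin w) f w).
  apply: eq_big_seq => m; rewrite mem_iota add0n ltnS => /andP[_ mM].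
  by rewrite -[RHS]big_filter (perm_big _ (inj_words_skip ds mM)) big_map.
under eq_bigr => m _ do rewrite big_mkcond.
rewrite exchange_big; apply: eq_big_seq => w.
rewrite mem_inj_words => /and3P[uw fw wM].
rewrite -big_mkcond big_const_seq iter_addr_0 -[LHS]mulr_natl count_notin //.
by rewrite (fits_size fw).
Qed.

(** The last hypothesis says that averaging [f] over all insertions multiplies it by [q M.+1 / q M].
    The double count with [f = 1] gives the ratio of the sizes of the two lists. *)
Lemma mean_inj_rec (q : nat -> F) f M : (N <= M)%N -> (forall k, 0 < q k) ->
  {in inj_words M ds, forall w, q M * \sum_(m <- iota 0 M.+1) f (map (bump m) w) =
     M.+1%:R * q M.+1 * f w} ->
  mean (inj_words M.+1 ds) f = q M.+1 / q M * mean (inj_words M ds) f.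
Proof.
move=> NM qp fE.
have d0 : (M.+1 - N)%:R != 0 :> F by rewrite pnatr_eq0; lia.
have M0 : M.+1%:R != 0 :> F by rewrite pnatr_eq0.
have q0 : q M != 0 by rewrite gt_eqF.
have sz : (size (inj_words M.+1 ds))%:R = M.+1%:R / (M.+1 - N)%:R * (size (inj_words M ds))%:R :> F.
  have := sum_inj_insert M (fun _ => 1).
  rewrite [X in _ = _ * X]big_const_seq count_predT iter_addr_0 => H.
  rewrite (eq_bigr (fun _ => M.+1%:R)) in H; last first.
    by move=> w _; rewrite big_const_seq count_predT iter_addr_0 size_iota.
  rewrite big_const_seq count_predT iter_addr_0 -mulr_natr in H.
  by apply: (mulfI d0); rewrite -H; field.
have sf : \sum_(w <- inj_words M.+1 ds) f w =
   M.+1%:R * q M.+1 / (q M * (M.+1 - N)%:R) * \sum_(w <- inj_words M ds) f w.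
  apply: (mulfI d0); rewrite -sum_inj_insert; apply: (mulfI q0).
  rewrite mulr_sumr (eq_big_seq _ fE) -mulr_sumr; field; by rewrite d0.
have [s0|s0] := eqVneq (size (inj_words M ds)) 0%N.
  by rewrite /mean sz s0 mulr0 !invr0 !mulr0.
by rewrite /mean sz sf; field; rewrite pnatr_eq0 s0 q0 d0 addrC natr1 M0.
Qed.

(** Telescoping down to alphabet size [N], where the words are permutations of [0, ..., N - 1]. *)
Lemma mean_inj_base (q : nat -> F) f M : (N <= M)%N -> (forall k, 0 < q k) ->
  (forall k, {in inj_words k ds, forall w, q k * \sum_(m <- iota 0 k.+1) f (map (bump m) w) =
     k.+1%:R * q k.+1 * f w}) ->
  mean (inj_words M ds) f = q M / q N * mean (inj_words N ds) f.
Proof.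
move=> NM qp fE; rewrite -(subnKC NM); elim: (M - N)%N => [|k IH].
  by rewrite addn0 divff ?gt_eqF // mul1r.
rewrite addnS (mean_inj_rec (q := q)) ?IH //; last by lia.
  by field; rewrite !gt_eqF.
Qed.

(* For a word with distinct letters this is its standardization, a permutation of 1, ..., N. *)
Definition stdv w : seq nat := [seq count (fun u => u <= v)%N w | v <- w].

Lemma stdv_bump m w : stdv (map (bump m) w) = stdv w.
Proof.
rewrite /stdv -map_comp; apply: eq_map => v /=; rewrite count_map.
by apply: eq_count => u /=; rewrite leq_bump2.
Qed.

Lemma inj_words_perm w : w \in inj_words N ds -> perm_eq w (iota 0 N).
Proof.
rewrite mem_inj_words => /and3P[uw fw wN].
apply: uniq_perm (iota_uniq _ _) _ => //; apply/(uniq_min_size uw _ _).2.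
  by move=> v /(allP wN); rewrite mem_iota.
by rewrite size_iota (fits_size fw).
Qed.

Lemma stdv_inj w : w \in inj_words N ds -> stdv w = map succn w.
Proof.
move=> wU; have pw := inj_words_perm wU; apply/eq_in_map => v vw.
rewrite (permP pw); have : (v < N)%N by move: vw; rewrite (perm_mem pw) mem_iota.
move: (N) => k vk; rewrite -(subnKC vk) iotaD count_cat -[RHS]addn0; congr addn.
  rewrite (eq_in_count (a2 := predT)) ?count_predT ?size_iota // => u.
  by rewrite mem_iota => /andP[_]; rewrite add0n ltnS => ->.
rewrite (eq_in_count (a2 := pred0)) ?count_pred0 // => u.
by rewrite mem_iota add0n ltnNge => /andP[/negbTE-> _].
Qed.

(* Inserting a new value multiplies the sum of this statistic by exactly M + 3, which fails for
   the plain product (u + 1) (v + 1). *)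
Definition pair_stat (u v : nat) : nat := (minn u v).+1 * (maxn u v).+2.

Lemma pair_statC u v : pair_stat u v = pair_stat v u.
Proof. by rewrite /pair_stat minnC maxnC. Qed.

Lemma pair_stat_le u v : (u <= v)%N -> pair_stat u v = (u.+1 * v.+2)%N.
Proof. by move=> uv; rewrite /pair_stat (minn_idPl uv) (maxn_idPr uv). Qed.

Lemma leq_pair_stat u v : (u.+1 * v.+1 <= pair_stat u v)%N.
Proof.
have [uv|/ltnW vu] := leqP u v; last rewrite pair_statC mulnC.
  by rewrite pair_stat_le // leq_mul2l leqnSn orbT.
by rewrite pair_stat_le // leq_mul2l leqnSn orbT.
Qed.

(** An inserted value [m <= u] shifts both letters, one with [u < m <= v] shifts only [v], and one
    above [v] shifts neither. *)
Lemma sum_bump2 (H : nat -> nat -> nat) M u v : (u <= v)%N -> (v < M)%N ->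
  (\sum_(m <- iota 0 M.+1) H (bump m u) (bump m v) =
   u.+1 * H u.+1 v.+1 + (v - u) * H u v.+1 + (M - v) * H u v)%N.
Proof.
move=> uv vM; rewrite -[iota 0 M.+1]/(index_iota 0 M.+1).
rewrite (@big_cat_nat _ _ _ v.+1) //=; last by lia.
rewrite (@big_cat_nat _ _ _ u.+1) //=.
congr (_ + _ + _)%N.
- rewrite (eq_big_nat _ _ (F2 := fun _ => H u.+1 v.+1)) ?sum_nat_const_nat ?subn0 // => m mu.
  by rewrite /bump; do 2 (rewrite (_ : (m <= _)%N = true); last by lia).
- rewrite (eq_big_nat _ _ (F2 := fun _ => H u v.+1)) ?sum_nat_const_nat ?subSS // => m mu.
  rewrite /bump (_ : (m <= u)%N = false); last by lia.
  by rewrite (_ : (m <= v)%N = true); last by lia.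
rewrite (eq_big_nat _ _ (F2 := fun _ => H u v)) ?sum_nat_const_nat ?subSS // => m mu.
rewrite /bump (_ : (m <= u)%N = false); last by lia.
by rewrite (_ : (m <= v)%N = false); last by lia.
Qed.

Lemma sum_bump1 M u : (u < M)%N ->
  (\sum_(m <- iota 0 M.+1) (bump m u).+1 = M.+2 * u.+1)%N.
Proof.
move=> uM; rewrite (@sum_bump2 (fun u _ => u.+1) M u u) // subnn.
rewrite -(subnKC uM); move: (M - u.+1)%N => k; rewrite (_ : (u.+1 + k - u = k.+1)%N); last by lia.
by nia.
Qed.

Lemma sum_bump_pair M u v : (u < M)%N -> (v < M)%N ->
  (\sum_(m <- iota 0 M.+1) pair_stat (bump m u) (bump m v) = M.+3 * pair_stat u v)%N.
Proof.
wlog uv : u v / (u <= v)%N.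
  move=> H uM vM; have [uv|/ltnW vu] := leqP u v; first exact: H.
  by rewrite pair_statC -H //; apply: eq_bigr => m _; rewrite pair_statC.
move=> uM vM; rewrite sum_bump2 // !pair_stat_le; try lia.
rewrite -(subnKC vM); move: (M - v.+1)%N => k; rewrite (_ : (v.+1 + k - v = k.+1)%N); last by lia.
rewrite -(subnKC uv); move: (v - u)%N => j; rewrite addKn; nia.
Qed.

(** Serves the covariance of one letter with the sum of all letters. Induction on [n] starting at
    [u + 1], where [u] is the maximum of every pair; in the later terms it is the minimum. *)
Lemma sum_pair_stat n u : (u < n)%N ->
  (2 * (\sum_(v <- iota 0 n) pair_stat u v) = u.+1 * (n ^ 2 + 3 * n - u))%N.
Proof.
move=> un; have -> : iota 0 n = index_iota 0 n by rewrite /index_iota subn0.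
rewrite -(subnKC un).
elim: (n - u.+1)%N => [|k IH]; last first.
  rewrite addnS big_nat_recr //= mulnDr {}IH pair_stat_le; last by lia.
  rewrite !expnS expn0; nia.
rewrite addn0 (eq_big_nat _ _ (F2 := fun v => u.+2 * v.+1)%N); last first.
  by move=> v vu; rewrite pair_statC pair_stat_le; [rewrite mulnC|lia].
rewrite -big_distrr /= mulnCA.
have -> : (2 * \sum_(0 <= v < u.+1) v.+1 = u.+1 * u.+2)%N.
  by elim: u {un} => [|u IH]; [rewrite big_nat1|rewrite big_nat_recr //= mulnDr IH; nia].
rewrite !expnS expn0; nia.
Qed.

(** The rank over [N + 1]: the mean of the order statistic of that rank among [N] uniform points of
    the unit interval. *)
Definition stat (i : nat) w : F := (nth 0%N (stdv w) i)%:R / N.+1%:R.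

(* With the shifts by 1, the mean of [scoord] given the ranks is exactly [stat]. *)
Definition scoord M (i : nat) w : F := (nth 0%N w i).+1%:R / M.+1%:R.

Lemma inj_words_lt M w i : w \in inj_words M ds -> (i < N)%N -> (nth 0%N w i < M)%N.
Proof.
rewrite mem_inj_words => /and3P[_ fw wM] iN.
by apply: (allP wM); rewrite mem_nth // (fits_size fw).
Qed.

Lemma inj_words_size M w : w \in inj_words M ds -> size w = N.
Proof. by rewrite mem_inj_words => /and3P[_ /fits_size]. Qed.

(** Insertion does not change the standardization, so [q = 1]: the relative order has the same law
    for every alphabet size. *)
Lemma mean_inj_stdv M (Phi : seq nat -> F) : (N <= M)%N ->
  mean (inj_words M ds) (fun w => Phi (stdv w)) =
  mean (inj_words N ds) (fun w => Phi (map succn w)).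
Proof.
move=> NM; rewrite (@mean_inj_base (fun _ => 1) (fun w => Phi (stdv w)) _ NM) //.
  by rewrite divr1 mul1r; apply: eq_mean => w /stdv_inj ->.
move=> k w _; rewrite mul1r mulr1.
rewrite (eq_bigr (fun _ => Phi (stdv w))) => [|m _]; last by rewrite stdv_bump.
by rewrite big_const_seq count_predT iter_addr_0 size_iota mulr_natl.
Qed.

(** Insertion multiplies the sum of a letter plus one by [M + 2], hence [q k = k + 1]; at [M = N] a
    letter plus one is its rank. *)
Lemma mean_inj_coord M (Phi : seq nat -> F) i : (N <= M)%N -> (i < N)%N ->
  mean (inj_words M ds) (fun w => Phi (stdv w) * scoord M i w) =
  mean (inj_words M ds) (fun w => Phi (stdv w) * stat i w).
Proof.
move=> NM iN.
rewrite (@mean_inj_stdv M (fun s => Phi s * ((nth 0%N s i)%:R / N.+1%:R))) //.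
rewrite (eq_mean (v := fun w => M.+1%:R^-1 * (Phi (stdv w) * (nth 0%N w i).+1%:R))); last first.
  by move=> w _; rewrite /scoord; ring.
rewrite meanZ (@mean_inj_base (fun k => k.+1%:R) _ _ NM) //.
- rewrite (eq_mean (v := fun w => N.+1%:R * (Phi (map succn w) * ((nth 0%N (map succn w) i)%:R / N.+1%:R)))).
    by rewrite meanZ; field; rewrite addrC natr1 !pnatr_eq0 addrC natr1 pnatr_eq0.
  move=> w wU; rewrite (stdv_inj wU) (nth_map 0%N) ?(inj_words_size wU) //; field.
  by rewrite addrC natr1 pnatr_eq0.
move=> k w wU.
rewrite (eq_bigr (fun m => Phi (stdv w) * (bump m (nth 0%N w i)).+1%:R)); last first.
  by move=> m _; rewrite stdv_bump (nth_map 0%N) // (inj_words_size wU).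
rewrite -mulr_sumr -natr_sum sum_bump1 ?(inj_words_lt wU) // natrM; ring.
Qed.

Lemma mean_inj_pair M i j : (N <= M)%N -> (i < N)%N -> (j < N)%N ->
  mean (F := F) (inj_words M ds) (fun w => (pair_stat (nth 0%N w i) (nth 0%N w j))%:R) =
  (M.+1%:R * M.+2%:R) / (N.+1%:R * N.+2%:R) *
  mean (inj_words N ds) (fun w => (pair_stat (nth 0%N w i) (nth 0%N w j))%:R).
Proof.
move=> NM iN jN.
apply: (@mean_inj_base (fun k => k.+1%:R * k.+2%:R)) => // [k|k w wU].
  by apply: mulr_gt0; rewrite ltr0n.
under eq_bigr => m _ do rewrite !(nth_map 0%N) ?(inj_words_size wU) //.
rewrite -natr_sum sum_bump_pair ?(inj_words_lt wU) // natrM; ring.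
Qed.

(** Used with [a] a letter plus one, [n = N + 1] and [e = 1 / (M + 1)]; it bounds the contribution
    of one word to the mean squared distance of a scaled letter from its scaled rank. *)
Lemma second_moment_bound (a n e : F) : 0 <= a -> a <= n -> 0 < n -> 0 <= e -> e * n <= 1 ->
  (1 + e) * (a * (a + 1)) / (n * (n + 1)) - (a / n) ^+ 2 <= 2 / n.
Proof.
move=> a0 an n0 e0 en.
rewrite (_ : _ - _ = ((1 + e) * (a * (a + 1)) * n - a ^+ 2 * (n + 1)) / (n ^+ 2 * (n + 1))); last first.
  by field; rewrite !gt_eqF //; lra.
rewrite (_ : 2 / n = 2 * n * (n + 1) / (n ^+ 2 * (n + 1))); last first.
  by field; rewrite !gt_eqF //; lra.
rewrite ler_pM2r ?invr_gt0; last by apply: mulr_gt0; rewrite ?exprn_gt0 //; lra.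
have h1 : (e * n) * (a * (a + 1)) <= n * (n + 1).
  rewrite -[leRHS]mul1r; apply: ler_pM => //; first by apply: mulr_ge0 => //; apply: ltW.
    by apply: mulr_ge0 => //; lra.
  by apply: ler_pM => //; lra.
have h2 : a * n <= n * n by apply: ler_wpM2r => //; apply: ltW.
have := sqr_ge0 a; rewrite !expr2; nra.
Qed.

(** Same substitution as in [second_moment_bound]. The first product comes from [sum_pair_stat], the
    second from the mean [(n - 1) / 2] of the sum of all scaled letters. *)
Lemma row_sum_bound (a n e : F) : 0 <= a -> a <= n -> 1 <= n -> 0 <= e -> e * n <= 1 ->
  (1 + e) / (n * (n + 1)) * (a * (n ^+ 2 + n - 1 - a) / 2) - a / n * ((n - 1) / 2) <= 1.
Proof.
move=> a0 an n1 e0 en; have n0 : 0 < n by lra.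
rewrite (_ : _ - _ = ((1 + e) * (a * (n ^+ 2 + n - 1 - a)) - a * (n - 1) * (n + 1)) / (2 * n * (n + 1))); last first.
  by field; rewrite !gt_eqF //; lra.
rewrite ler_pdivrMr ?mul1r; last by apply: mulr_gt0; lra.
have ea1 : e * a <= 1 by apply: le_trans en; apply: ler_wpM2l.
have ea0 : 0 <= e * a by apply: mulr_ge0.
have h1 : e * a * (n ^+ 2 + n - 1 - a) <= n ^+ 2 + n.
  rewrite -[leRHS]mul1r; apply: ler_pM => //; rewrite expr2; nra.
have h2 : a * n <= n * n by apply: ler_wpM2r => //; apply: ltW.
rewrite expr2 in h1 *; nra.
Qed.

Lemma inv_succ_bound M : (N <= M)%N -> 0 <= M.+1%:R^-1 :> F /\ M.+1%:R^-1 * N.+1%:R <= 1 :> F.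
Proof.
move=> NM; split; first by rewrite invr_ge0.
by rewrite mulrC ler_pdivrMr ?ltr0n // mul1r ler_nat ltnS.
Qed.

Lemma mean_inj_scoord_stat2 M i : (N <= M)%N -> (i < N)%N ->
  mean (inj_words M ds) (fun w => (scoord M i w - stat i w) ^+ 2) <= 2 / N.+1%:R.
Proof.
move=> NM iN.
pose Phi (s : seq nat) : F := (nth 0%N s i)%:R / N.+1%:R.
have E1 := mean_inj_coord Phi NM iN.
(* By [E1] the cross term is twice the mean square of [stat], which leaves a difference of two
   second moments. *)
rewrite (eq_mean (v := fun w => (scoord M i w ^+ 2 - 2 * (Phi (stdv w) * scoord M i w))
   + Phi (stdv w) * stat i w)); last by move=> w _; rewrite /stat /Phi; ring.
rewrite meanD meanB meanZ E1.
have -> : forall x y : F, x - 2 * y + y = x - y by move=> x y; ring.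
rewrite (@mean_inj_stdv M (fun s => Phi s * ((nth 0%N s i)%:R / N.+1%:R))) //.
(* The square of a letter plus one is replaced by the larger [pair_stat], whose mean is known
   exactly. *)
apply: le_trans (lerB (y := mean (inj_words M ds) (fun w => M.+1%:R^-1 ^+ 2 *
    (pair_stat (nth 0%N w i) (nth 0%N w i))%:R)) _ (lexx _)) _.
  apply: ler_mean => w _; rewrite /scoord exprMn mulrC ler_wpM2l ?sqr_ge0 //.
  by rewrite pair_stat_le // -natrX ler_nat expnS expn1 leq_mul2l leqnSn orbT.
rewrite meanZ mean_inj_pair // mulrA -meanZ -meanB.
apply: mean_le_const => [|w wU]; first by rewrite divr_ge0.
have uN := inj_words_lt wU iN; rewrite /Phi (nth_map 0%N) ?(inj_words_size wU) //.
rewrite pair_stat_le //; move: (nth 0%N w i) uN => u uN.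
have [e0 en] := inv_succ_bound NM.
have := @second_moment_bound u.+1%:R N.+1%:R M.+1%:R^-1 _ _ _ e0 en.
rewrite ler0n ler_nat ltr0n => /(_ isT (leqW uN) isT); apply: le_trans.
rewrite natrM -[u.+2%:R]natr1 -[N.+2%:R]natr1 -[M.+2%:R]natr1.
rewrite le_eqVlt; apply/orP; left; apply/eqP; field.
by rewrite ![1 + _]addrC !natr1 !pnatr_eq0.
Qed.

Lemma sum_nth_inj (phi : nat -> nat) w : w \in inj_words N ds ->
  (\sum_(j < N) phi (nth 0 w j) = \sum_(v <- iota 0 N) phi v)%N.
Proof.
move=> wU; rewrite -(perm_big _ (inj_words_perm wU)) (big_nth 0%N) big_mkord.
by rewrite (inj_words_size wU).
Qed.

(** The moments are transferred to words over [N] letters, where a sum over positions is a sum over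
    all letters [0, ..., N - 1]; the estimate then holds word by word through [row_sum_bound]. *)
Lemma cov_inj_sum M i : (N <= M)%N -> (i < N)%N ->
  cov (inj_words M ds) (scoord M i) (fun w => \sum_(j < N) scoord M j w) <= 1.
Proof.
move=> NM iN; rewrite /cov.
have Ey j : (j < N)%N -> mean (inj_words M ds) (scoord M j) =
   mean (inj_words N ds) (fun w => (nth 0%N w j).+1%:R / N.+1%:R).
  move=> jN; have := mean_inj_coord (fun _ => 1) NM jN.
  rewrite (eq_mean (v := scoord M j)) => [->|w _]; last by rewrite mul1r.
  rewrite (@mean_inj_stdv M (fun s => 1 * ((nth 0%N s j)%:R / N.+1%:R))) //.
  by apply: eq_mean => w wU; rewrite mul1r (nth_map 0%N) // (inj_words_size wU).
pose S (w : seq nat) : F := \sum_(j < N) (pair_stat (nth 0%N w i) (nth 0%N w j))%:R.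
have ES : mean (inj_words M ds) (fun w => scoord M i w * \sum_(j < N) scoord M j w) <=
   M.+2%:R / (M.+1%:R * (N.+1%:R * N.+2%:R)) * mean (inj_words N ds) S.
  apply: (@le_trans _ _ (mean (inj_words M ds) (fun w => M.+1%:R^-1 ^+ 2 * S w))).
    apply: ler_mean => w _; rewrite /S !mulr_sumr; apply: ler_sum => j _.
    rewrite /scoord mulrACA -expr2 mulrC ler_wpM2l ?sqr_ge0 // -natrM ler_nat.
    exact: leq_pair_stat.
  rewrite meanZ !mean_sum (eq_bigr (fun j : 'I_N => (M.+1%:R * M.+2%:R) / (N.+1%:R * N.+2%:R) *
    mean (F := F) (inj_words N ds) (fun w => (pair_stat (nth 0%N w i) (nth 0%N w j))%:R))); last first.
    by move=> j _; exact: mean_inj_pair NM iN (ltn_ord j).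
  rewrite -mulr_sumr [leLHS]mulrA le_eqVlt; apply/orP; left; apply/eqP; congr (_ * _).
  have h (a b c : F) : a != 0 -> c != 0 -> a^-1 ^+ 2 * (a * b / c) = b / (a * c).
    by move=> a0 c0; field; rewrite a0 c0.
  by rewrite h ?mulf_neq0 ?pnatr_eq0 //.
have ET : mean (inj_words M ds) (fun w => \sum_(j < N) scoord M j w) =
   mean (inj_words N ds) (fun _ => N%:R / 2).
  rewrite mean_sum (eq_bigr (fun j : 'I_N => mean (inj_words N ds)
    (fun w => (nth 0%N w j).+1%:R / N.+1%:R))); last by move=> j _; apply: Ey.
  rewrite -mean_sum; apply: eq_mean => w wU; rewrite -mulr_suml -natr_sum.
  rewrite (sum_nth_inj succn wU).
  have H : forall n, (2 * (\sum_(v <- iota 0 n) v.+1) = n * n.+1)%N.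
    move=> n; have -> : iota 0 n = index_iota 0 n by rewrite /index_iota subn0.
    by elim: n => [|n IH]; [rewrite big_nil|rewrite big_nat_recr //= mulnDr IH; nia].
  have := congr1 (fun n => n%:R : F) (H N); rewrite !natrM => HN.
  have n0 : N.+1%:R != 0 :> F by rewrite pnatr_eq0.
  apply: (mulIf n0); rewrite divfK //; lra.
rewrite ET (Ey i iN); apply: le_trans (lerB ES (lexx _)) _.
have [U0|nU] := eqVneq (inj_words N ds) [::]; first by rewrite U0 !mean_nil !mulr0 subr0.
rewrite mean_const // [X in _ - X]mulrC -!meanZ -meanB; apply: mean_le_const => // w wU.
have uN := inj_words_lt wU iN.
rewrite /S -natr_sum (sum_nth_inj (pair_stat (nth 0%N w i)) wU).
have := sum_pair_stat uN; move: (nth 0%N w i) uN => u uN.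
move/(congr1 (fun n => n%:R : F)); rewrite !natrM natrB; last by nia.
rewrite natrD natrX natrM; set P := (\sum_(v <- _) _)%:R => HP.
have [e0 en] := inv_succ_bound NM.
have := @row_sum_bound u.+1%:R N.+1%:R M.+1%:R^-1 _ _ _ e0 en.
rewrite ler0n ler_nat ler1n => /(_ isT (leqW uN) isT); apply: le_trans.
have {HP} -> : P = u.+1%:R * (N%:R ^+ 2 + 3 * N%:R - u%:R) / 2 by lra.
rewrite -[N.+2%:R]natr1 -[M.+2%:R]natr1 -[N.+1%:R]natr1 -[u.+1%:R]natr1.
rewrite le_eqVlt; apply/orP; left; apply/eqP; field.
by rewrite ![1 + _]addrC !natr1 !pnatr_eq0.
Qed.
End Insertion.

(** * Scarcity of words with repeated letters *)

Fixpoint all_seqs (M n : nat) : seq (seq nat) :=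
  if n is n'.+1 then [seq x :: s | x <- iota 0 M, s <- all_seqs M n'] else [:: [::]].

Lemma size_all_seqs M n : size (all_seqs M n) = (M ^ n)%N.
Proof. by elim: n => //= n IH; rewrite size_allpairs IH size_iota expnS. Qed.

Lemma mem_all_seqs M n s :
  (s \in all_seqs M n) = all (fun v => v < M)%N s && (size s == n).
Proof.
elim: n s => [|n IH] s /=; first by rewrite inE; case: s => [|x s] //=; rewrite andbF.
apply/allpairsP/idP => [[[x s'] /= [xM s'A ->]]|].
  by move: s'A; rewrite IH /= eqSS => /andP[-> ->]; move: xM; rewrite mem_iota add0n => /= ->.
case: s => [|x s] //= /andP[/andP[xM sM] ss]; exists (x, s).
by rewrite mem_iota add0n xM IH sM.
Qed.

Lemma sum_mem_leq_size (M : nat) (s : seq nat) : (\sum_(x <- iota 0 M) (x \in s) <= size s)%N.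
Proof.
have -> : (\sum_(x <- iota 0 M) (x \in s) = count (mem s) (iota 0 M))%N.
  by rewrite -sum1_count [RHS]big_mkcond; apply: eq_bigr => x _ /=; case: (x \in s).
rewrite -size_filter; apply: uniq_leq_size; first by rewrite filter_uniq // iota_uniq.
by move=> x; rewrite mem_filter => /andP[].
Qed.

(** A new first letter creates a repetition only if it is one of the at most [n] letters of the
    tail; the recurrence closes because [n ^ 2 + n <= (n + 1) ^ 2]. *)
Lemma count_all_seqs_nonuniq M n :
  (count (fun s => ~~ uniq s) (all_seqs M n) * M <= n ^ 2 * M ^ n)%N.
Proof.
elim: n => [|n IH] //.
have le : (count (fun s => ~~ uniq s) (all_seqs M n.+1) <=
    M * count (fun s => ~~ uniq s) (all_seqs M n) + n * M ^ n)%N.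
  rewrite -!sum1_count big_mkcond big_allpairs_dep.
  apply: (@leq_trans (\sum_(x <- iota 0 M) \sum_(s <- all_seqs M n) (~~ uniq s + (x \in s)))).
    by apply: leq_sum => x _; apply: leq_sum => s _ /=; case: (x \in s); case: (uniq s).
  rewrite exchange_big /=.
  under eq_bigr => s _ do rewrite big_split /= big_const_seq count_predT size_iota iter_addn_0.
  rewrite big_split /=; apply: leq_add.
    rewrite [X in (_ <= _ * X)%N]big_mkcond /= big_distrr /=; apply: leq_sum => s _.
    by case: (uniq s); rewrite ?mul0n ?mul1n ?muln1.
  apply: (@leq_trans (\sum_(s <- all_seqs M n) n)%N).
    rewrite big_seq [leqRHS]big_seq; apply: leq_sum => s.
    rewrite mem_all_seqs => /andP[_ /eqP <-]; exact: sum_mem_leq_size.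
  by rewrite big_const_seq count_predT size_all_seqs iter_addn_0.
rewrite expnS; move: IH le.
set c := count _ _; set c' := count _ _; set P := (M ^ n)%N; rewrite !expnS !expn0; nia.
Qed.

Lemma words_nonuniq_count M ds :
  ((size (words M ds) - size (inj_words M ds)) * M <= (size ds).+1 ^ 2 * M ^ (size ds).+1)%N.
Proof.
apply: leq_trans (count_all_seqs_nonuniq M (size ds).+1); rewrite leq_mul2r; apply/orP; right.
rewrite -(count_predC uniq (words M ds)) size_filter addKn -!size_filter.
apply: uniq_leq_size; first by rewrite filter_uniq // words_uniq.
move=> w; rewrite !mem_filter mem_words mem_all_seqs => /and3P[/= -> fw ->].
by rewrite (fits_size fw) eqxx.
Qed.

(** Every factor of the falling factorial is at least [M / 2]. *)
Lemma expn_leq_ffact M n k : (k <= n)%N -> (2 * n <= M)%N -> (M ^ k <= 2 ^ k * M ^_ k)%N.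
Proof.
move=> kn nM; elim: k kn => [|k IH] kn; first by rewrite ffactn0.
rewrite ffactnSr !expnS; have := IH (ltnW kn).
move: (M ^ k)%N (M ^_ k)%N (2 ^ k)%N => p q r.
have : (M <= 2 * (M - k))%N by lia.
move: (M - k)%N => j; nia.
Qed.

(** * Comparison of all words with words of distinct letters *)

Section Comparison.
Variables (F : realFieldType) (ds : seq bool).
Let N := (size ds).+1.

Lemma size_inj_words M : (N <= M)%N ->
  (size (inj_words M ds) * N`! = M ^_ N * size (inj_words N ds))%N.
Proof.
move=> NM; rewrite -(subnKC NM); elim: (M - N)%N => [|k IH].
  by rewrite addn0 ffactnn mulnC.
have d0 : (N + k.+1 - N != 0)%N by lia.
have H : ((N + k).+1 * size (inj_words (N + k) ds) =
   ((N + k).+1 - N) * size (inj_words (N + k).+1 ds))%N.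
  have := sum_inj_insert ds (N + k) (fun _ => 1 : F).
  rewrite [X in _ = _ * X]big_const_seq count_predT iter_addr_0.
  rewrite (eq_bigr (fun _ => (N + k).+1%:R)); last first.
    by move=> w _; rewrite big_const_seq count_predT iter_addr_0 size_iota.
  rewrite big_const_seq count_predT iter_addr_0 -[_ *+ size _]mulr_natr -!natrM => /eqP.
  by rewrite eqr_nat => /eqP.
rewrite addnS in d0 *; apply/eqP.
rewrite -(eqn_pmul2l (m := ((N + k).+1 - N)%N)) ?lt0n //; apply/eqP.
transitivity ((N + k).+1 * ((N + k) ^_ N * size (inj_words N ds)))%N.
  by rewrite -IH !mulnA H.
have e := ffactSS (N + k) N; rewrite ffactnSr mulnC in e.
by rewrite [LHS]mulnA [RHS]mulnA e.
Qed.

(** There are at least [M ^_ N / N!] words with distinct letters and [M ^ N <= 2 ^ N * M ^_ N], so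
    for fixed [N] repetitions have relative weight of order [1 / M]. *)
Lemma words_nonuniq_ratio M : inj_words N ds != [::] -> (2 * N <= M)%N ->
  ((size (words M ds) - size (inj_words M ds)) * M <=
    (N ^ 2 * 2 ^ N * N`!) * size (inj_words M ds))%N.
Proof.
move=> nU NM; apply: leq_trans (words_nonuniq_count M ds) _.
rewrite -/N -[leqRHS]mulnA -[leqRHS]mulnA; apply: leq_mul => //.
apply: leq_trans (expn_leq_ffact (leqnn N) NM) _; apply: leq_mul => //.
rewrite mulnC size_inj_words; last by lia.
by apply: leq_pmulr; rewrite lt0n size_eq0.
Qed.

Lemma mean_filter_close (T : eqType) (Om : seq T) (p : pred T) (f : T -> F) :
  [seq w <- Om | p w] != [::] -> {in Om, forall w, `|f w| <= 1} ->
  `|mean Om f - mean [seq w <- Om | p w] f| <=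
    2 * (size Om - size [seq w <- Om | p w])%:R / (size Om)%:R.
Proof.
move=> nU f1; rewrite /mean big_filter (bigID p) /=.
have szE : (size Om = size [seq w <- Om | p w] + size [seq w <- Om | ~~ p w])%N.
  by rewrite !size_filter -(count_predC p Om).
have : (0 < size [seq w <- Om | p w])%N by rewrite lt0n size_eq0.
have A : `|\sum_(w <- Om | p w) f w| <= (size [seq w <- Om | p w])%:R.
  apply: le_trans (ler_norm_sum _ _ _) _; rewrite size_filter -sum1_count natr_sum.
  rewrite [leLHS]big_seq_cond [leRHS]big_seq_cond.
  by apply: ler_sum => w /andP[wO _]; apply: f1.
have B : `|\sum_(w <- Om | ~~ p w) f w| <= (size [seq w <- Om | ~~ p w])%:R.
  apply: le_trans (ler_norm_sum _ _ _) _; rewrite size_filter -sum1_count natr_sum.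
  rewrite [leLHS]big_seq_cond [leRHS]big_seq_cond.
  by apply: ler_sum => w /andP[wO _]; apply: f1.
move: A B szE; set sA := \sum_(w <- _ | _) _; set sB := \sum_(w <- _ | _) _.
move: (size _) (size _) (size _) => n m k A B -> k0; rewrite addKn.
have kp : 0 < k%:R :> F by rewrite ltr0n.
have np : 0 < (k + m)%:R :> F by rewrite ltr0n; lia.
rewrite ler_pdivlMr // -[X in _ * X](gtr0_norm np) -normrM.
have -> : ((sA + sB) / (k + m)%:R - sA / k%:R) * (k + m)%:R = sB - sA * (m%:R / k%:R).
  by rewrite natrD in np *; field; rewrite !gt_eqF.
apply: le_trans (ler_normB _ _) _; rewrite normrM.
have -> : 2 * m%:R = m%:R + k%:R * (m%:R / k%:R) :> F by field; rewrite gt_eqF.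
have mk : 0 <= m%:R / k%:R :> F by rewrite divr_ge0.
by rewrite lerD // [X in _ * X]ger0_norm // ler_wpM2r.
Qed.

Lemma mean_words_close M (f : seq nat -> F) : inj_words N ds != [::] -> (2 * N <= M)%N ->
  {in words M ds, forall w, `|f w| <= 1} ->
  `|mean (words M ds) f - mean (inj_words M ds) f| <=
    2 * (N ^ 2 * 2 ^ N * N`!)%:R / M%:R.
Proof.
move=> nU NM f1.
have k0 : (0 < size (inj_words M ds))%N.
  have : (0 < size (inj_words M ds) * N`!)%N.
    rewrite size_inj_words; last by lia.
    by rewrite muln_gt0 ffact_gt0 lt0n size_eq0 nU andbT; lia.
  by rewrite muln_gt0 => /andP[].
have ne : inj_words M ds != [::] by rewrite -size_eq0 -lt0n.
apply: le_trans (mean_filter_close ne f1) _.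
have n0 : (0 < size (words M ds))%N.
  by apply: leq_trans k0 _; rewrite size_filter count_size.
have M0 : (0 < M)%N by lia.
rewrite ler_pdivrMr ?ltr0n // mulrAC ler_pdivlMr ?ltr0n // -!mulrA ler_wpM2l //.
rewrite -!natrM ler_nat; apply: leq_trans (words_nonuniq_ratio nU NM) _.
by rewrite leq_mul2l size_filter count_size orbT.
Qed.
End Comparison.

(** * Asymptotic factorization *)

Section CovariancePerturbation.
Variables (F : realFieldType) (T : eqType).
Implicit Types (Om : seq T) (u v : T -> F).

Lemma norm_mulB_le (a b a' b' : F) : `|b| <= 1 -> `|a'| <= 1 ->
  `|a * b - a' * b'| <= `|a - a'| + `|b - b'|.
Proof.
move=> b1 a1; rewrite (_ : _ - _ = (a - a') * b + a' * (b - b')); last by ring.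
apply: le_trans (ler_normD _ _) _; rewrite !normrM lerD //.
  by rewrite -[leRHS]mulr1 ler_wpM2l.
by rewrite -[leRHS]mul1r ler_wpM2r.
Qed.

Lemma norm_prod_le1 (k : nat) (a : nat -> F) : (forall j, (j < k)%N -> `|a j| <= 1) ->
  `|\prod_(j < k) a j| <= 1.
Proof.
move=> a1; rewrite normr_prod; elim: k a1 => [|k IH] a1; first by rewrite big_ord0.
rewrite big_ord_recr /= mulr_ile1 ?prodr_ge0 ?a1 //.
by apply: IH => j jk; apply: a1; apply: ltnW.
Qed.

Lemma norm_prodB_le (k : nat) (a b : nat -> F) :
  (forall j, (j < k)%N -> `|a j| <= 1) -> (forall j, (j < k)%N -> `|b j| <= 1) ->
  `|\prod_(j < k) a j - \prod_(j < k) b j| <= \sum_(j < k) `|a j - b j|.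
Proof.
elim: k => [|k IH] a1 b1; first by rewrite !big_ord0 subrr normr0.
rewrite !big_ord_recr /=.
have a1' j : (j < k)%N -> `|a j| <= 1 by move=> jk; apply: a1; apply: ltnW.
have b1' j : (j < k)%N -> `|b j| <= 1 by move=> jk; apply: b1; apply: ltnW.
apply: le_trans (norm_mulB_le _ _ _ _) _; rewrite ?a1 ?norm_prod_le1 //.
by rewrite lerD2r; apply: IH.
Qed.

Lemma norm_mean_le1 Om u : {in Om, forall w, `|u w| <= 1} -> `|mean Om u| <= 1.
Proof. by move=> u1; apply: le_trans (ler_norm_mean _ _) _; apply: mean_le_const. Qed.

Lemma norm_covB_le Om u v u' v' :
  {in Om, forall w, `|u w| <= 1} -> {in Om, forall w, `|v w| <= 1} ->
  {in Om, forall w, `|u' w| <= 1} -> {in Om, forall w, `|v' w| <= 1} ->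
  `|cov Om u v - cov Om u' v'| <=
  2 * (mean Om (fun w => `|u w - u' w|) + mean Om (fun w => `|v w - v' w|)).
Proof.
move=> u1 v1 u'1 v'1; rewrite /cov.
rewrite (_ : forall a b c e : F, a - b - (c - e) = (a - c) - (b - e)); last by move=> *; ring.
apply: le_trans (ler_normB _ _) _; rewrite mulrDl mul1r.
apply: lerD.
  rewrite -meanD; apply: le_trans (norm_meanB_le _ _ _) _; apply: ler_mean => w wO.
  by apply: norm_mulB_le; auto.
apply: le_trans (norm_mulB_le _ _ _ _) _; rewrite ?norm_mean_le1 //.
by apply: lerD; apply: norm_meanB_le.
Qed.

Lemma norm_cov_change_le Om Om' u v d :
  (forall f : T -> F, {in Om, forall w, `|f w| <= 1} -> `|mean Om f - mean Om' f| <= d) ->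
  {subset Om' <= Om} ->
  {in Om, forall w, `|u w| <= 1} -> {in Om, forall w, `|v w| <= 1} ->
  `|cov Om u v - cov Om' u v| <= 3 * d.
Proof.
move=> cl sub u1 v1; rewrite /cov.
have uv1 : {in Om, forall w, `|u w * v w| <= 1}.
  by move=> w wO; rewrite normrM mulr_ile1 // ?u1 ?v1.
have mu : `|mean Om v| <= 1 by apply: norm_mean_le1.
have mu' : `|mean Om' u| <= 1 by apply: norm_mean_le1 => w /sub; apply: u1.
have h1 := cl _ uv1; have h2 := le_trans (norm_mulB_le _ _ mu mu') (lerD (cl _ u1) (cl _ v1)).
rewrite (_ : forall a b c e : F, a - b - (c - e) = (a - c) - (b - e)); last by move=> *; ring.
by apply: le_trans (ler_normB _ _) _; lra.
Qed.

Lemma cov_affine Om (c k : F) u v :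
  cov Om (fun w => (u w + c) * k) (fun w => (v w + c) * k) = k ^+ 2 * cov Om u v.
Proof.
rewrite -covZ; apply/eqP; rewrite eq_le; apply/andP.
by split; apply: cov_le => s t _ _; rewrite le_eqVlt; apply/orP; left; apply/eqP; ring.
Qed.

End CovariancePerturbation.

Lemma cov_scoord (F : realFieldType) Om M i j :
  cov Om (scoord F M i) (scoord F M j) = M.+1%:R^-1 ^+ 2 * cov Om (coord F i) (coord F j).
Proof.
rewrite -(cov_affine Om 1 (M.+1%:R^-1) (coord F i) (coord F j)).
rewrite /cov; congr (_ - _ * _); apply: eq_mean => w _; by rewrite /scoord /coord !natr1.
Qed.

Lemma norm_scoord_le1 (F : realFieldType) M ds w i : w \in words M ds -> (i < (size ds).+1)%N ->
  `|scoord F M i w| <= 1.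
Proof.
move=> wW iN; have M0 : (0 < M)%N.
  by case/orP: (words_nil_or_gt0 M ds) wW => [/eqP->|//]; rewrite in_nil.
rewrite /scoord ger0_norm ?divr_ge0 // ler_pdivrMr ?ltr0n // mul1r ler_nat.
by apply: leqW; apply: mem_words_lt wW M0.
Qed.

Definition lip1 (F : realFieldType) (l : F) (g : F -> F) :=
  (forall x, `|g x| <= 1) /\ (forall x y, `|g x - g y| <= l * `|x - y|).

(** Error budget per unit of [t]: [8 * l * k] pays for replacing ranks by scaled letters in [k]
    factors, [2 * l ^ 2 + 1] for the conditional mean estimate, and the last 1 for repeated
    letters. *)
Definition decorrelation_rate (F : realFieldType) (k : nat) (l : F) : F :=
  8 * l * k%:R + 2 * l ^+ 2 + 2.

(** * Decorrelation of distant coordinates *)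

Section Decorrelation.
Variables (F : archiRealFieldType) (ds : seq bool).
Let N := (size ds).+1.
Implicit Types (M : nat) (f : nat -> F -> F) (g : F -> F) (l d t : F).

(** On words over [N] letters this is [sigma(i + 1) / N] for the corresponding permutation of
    [1, ..., N]. *)
Definition zcoord (i : nat) (w : seq nat) : F := (nth 0%N w i).+1%:R / N%:R.

Lemma mean_words_inj_small d : 0 < d -> inj_words N ds != [::] ->
  exists M, (2 * N <= M)%N /\ forall u : seq nat -> F,
    {in words M ds, forall w, `|u w| <= 1} ->
    `|mean (words M ds) u - mean (inj_words M ds) u| <= d.
Proof.
move=> d0 nU; set K : F := 2 * (N ^ 2 * 2 ^ N * N`!)%:R.
have K0 : 0 <= K / d by apply: divr_ge0; [apply: mulr_ge0 | apply: ltW].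
(* [Num.bound] supplies a natural number above [K / d], which makes the error [K / M] at most
   [d]. *)
exists (2 * N + Num.bound (K / d))%N; split=> [|u u1]; first exact: leq_addr.
apply: le_trans (mean_words_close nU (leq_addr _ _) u1) _; rewrite -/N -/K.
rewrite ler_pdivrMr ?ltr0n ?addn_gt0 // mulrC -ler_pdivrMr //.
apply: le_trans (ltW (archi_boundP K0)) _; rewrite ler_nat; exact: leq_addl.
Qed.

Lemma subset_inj_words M : {subset inj_words M ds <= words M ds}.
Proof. by move=> w; rewrite mem_filter => /andP[]. Qed.

Lemma cov_words_scoord_le M d a n b : (N <= M)%N ->
  (forall u : seq nat -> F, {in words M ds, forall w, `|u w| <= 1} ->
    `|mean (words M ds) u - mean (inj_words M ds) u| <= d) ->
  3 * d * N%:R <= 1 -> (a + n <= b)%N -> (b < N)%N ->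
  n%:R * cov (words M ds) (scoord F M a) (scoord F M b) <= 2.
Proof.
move=> NM cl dN anb bN; have aN : (a < N)%N by lia.
apply: (@le_trans _ _ (cov (words M ds) (scoord F M a) (fun w => \sum_(j < N) scoord F M j w))).
  rewrite cov_sumr (eq_bigr (fun j : 'I_N => M.+1%:R^-1 ^+ 2 * cov (words M ds) (coord F a) (coord F j))).
    by rewrite -mulr_sumr -cov_sumr cov_scoord mulrCA; apply: ler_wpM2l (cov_coord_gap F M anb bN); apply: sqr_ge0.
  by move=> j _; rewrite cov_scoord.
have := cov_inj_sum F NM aN; rewrite -/N !cov_sumr => Hc.
(* Each of the [N] covariances moves by at most [3 * d] on passing to distinct letters, so the total
   is at most [1 + 3 * d * N]. *)
apply: le_trans (_ : \sum_(j < N) (cov (inj_words M ds) (scoord F M a) (scoord F M j) + 3 * d) <= _).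
  apply: ler_sum => j _; rewrite -lerBlDl; apply: le_trans (ler_norm _) _.
  apply: norm_cov_change_le cl (@subset_inj_words M) _ _ => w wW; exact: norm_scoord_le1 wW _.
by rewrite big_split /= sumr_const card_ord -mulr_natr; lra.
Qed.

Lemma mean_inj_zcoord M i t : (N <= M)%N -> (i < N)%N -> 0 < t ->
  mean (inj_words M ds) (fun w => `|(nth 0%N (stdv w) i)%:R / N%:R - scoord F M i w|) <=
  t + 2 / N.+1%:R / t + N.+1%:R^-1.
Proof.
move=> NM iN t0.
have N0 : 0 < N%:R :> F by rewrite ltr0n.
have N10 : 0 < N.+1%:R :> F by rewrite ltr0n.
have [->|nU] := eqVneq (inj_words M ds) [::].
  by rewrite mean_nil !addr_ge0 ?divr_ge0 ?invr_ge0 // ltW.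
apply: (@le_trans _ _ (mean (inj_words M ds) (fun w =>
  (t + t^-1 * (scoord F M i w - stat F ds i w) ^+ 2) + N.+1%:R^-1))).
  apply: ler_mean => w wU.
  (* Split at [stat]: replacing the denominator [N + 1] by [N] costs at most [1 / (N + 1)], and the
     rest satisfies [|e| <= t + e ^ 2 / t]. *)
  rewrite (_ : _ - _ = ((nth 0%N (stdv w) i)%:R / N%:R - stat F ds i w) - (scoord F M i w - stat F ds i w)); last by ring.
  apply: le_trans (ler_normB _ _) _; rewrite addrC; apply: lerD.
    set e := scoord F M i w - _.
    rewrite -(ler_pM2r t0) mulrDl [t^-1 * _]mulrC divfK ?gt_eqF //.
    rewrite -[e ^+ 2]real_normK ?num_real //.
    have := sqr_ge0 (`|e| - t); have := normr_ge0 e; nra.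
  rewrite /stat -/N -mulrBr normrM ger0_norm ?ler0n //.
  have -> : N%:R^-1 - N.+1%:R^-1 = (N%:R * N.+1%:R)^-1 :> F.
    by rewrite -natr1 in N10 *; field; rewrite !gt_eqF.
  rewrite ger0_norm ?invr_ge0 ?mulr_ge0 // invfM mulrA -[leRHS]mul1r ler_wpM2r ?invr_ge0 //.
  rewrite ler_pdivrMr // mul1r ler_nat (nth_map 0%N) ?(inj_words_size wU) //.
  by apply: leq_trans (count_size _ _) _; rewrite (inj_words_size wU).
rewrite !meanD !mean_const // meanZ lerD2r lerD2l mulrC ler_pM2r ?invr_gt0 //.
exact: mean_inj_scoord_stat2.
Qed.

Lemma decorrelation_rate_ge0 (k : nat) l : 0 <= l -> 0 <= decorrelation_rate k l.
Proof.
move=> l0; rewrite /decorrelation_rate.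
have : 0 <= l * k%:R by apply: mulr_ge0.
have := sqr_ge0 l; lra.
Qed.

(** Four transfers: from permutations to ranks in words over a large alphabet ([E1], exact), to
    scaled letters ([S2]), to words with repetitions ([S3]), where the Markov chain estimate applies
    ([S4]). *)
Lemma cov_zcoord_small (k : nat) (p : nat -> nat) f g l t (a b n : nat) :
  0 <= l -> 0 < t -> t <= 1 -> 1 <= t ^+ 2 * n%:R ->
  (forall j, (j < k)%N -> (p j <= a)%N) -> (a + n <= b)%N -> (b < N)%N ->
  (forall j, lip1 l (f j)) -> lip1 l g ->
  `|cov (inj_words N ds) (fun w => \prod_(j < k) f j (zcoord (p j) w)) (fun w => g (zcoord b w))|
  <= decorrelation_rate k.+1 l * t.
Proof.
move=> l0 t0 t1 tn pa anb bN fl [g1 gl].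
have f1 j x : `|f j x| <= 1 by case: (fl j).
have fL j x y : `|f j x - f j y| <= l * `|x - y| by case: (fl j).
have [->|nU] := eqVneq (inj_words N ds) [::].
  by rewrite /cov !mean_nil mulr0 subr0 normr0 mulr_ge0 ?decorrelation_rate_ge0 // ltW.
(* This choice of [d] gives both [3 * d * N = t <= 1] and [3 * d <= t]. *)
have d0 : 0 < t / (3 * N%:R) by rewrite divr_gt0 // mulr_gt0 // ltr0n.
have [M [NM2 cl]] := mean_words_inj_small d0 nU.
move: cl d0; set d := t / (3 * N%:R) => cl d0.
have NM : (N <= M)%N by lia.
have N0 : 0 < N%:R :> F by rewrite ltr0n.
have dN : 3 * d * N%:R = t by rewrite /d; field; rewrite gt_eqF.
have dt : 3 * d <= t.
  rewrite -dN -[leLHS]mulr1; apply: ler_wpM2l; last by rewrite ler1n.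
  by apply: mulr_ge0 => //; apply: ltW.
set U := inj_words M ds; set W := words M ds.
have pN j : (j < k)%N -> (p j < N)%N by move=> /pa; lia.
pose Phi (s : seq nat) : F := \prod_(j < k) f j ((nth 0%N s (p j))%:R / N%:R).
pose G (s : seq nat) : F := g ((nth 0%N s b)%:R / N%:R).
pose Psi (w : seq nat) : F := \prod_(j < k) f j (scoord F M (p j) w).
pose H (w : seq nat) : F := g (scoord F M b w).
have Phi1 s : `|Phi s| <= 1
  by apply: (norm_prod_le1 (a := fun j => f j ((nth 0%N s (p j))%:R / N%:R))).
have Psi1 w : `|Psi w| <= 1 by apply: (norm_prod_le1 (a := fun j => f j (scoord F M (p j) w))).
have G1 s : `|G s| <= 1 by apply: g1.
have H1 w : `|H w| <= 1 by apply: g1.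
have E1 : cov (inj_words N ds) (fun w => \prod_(j < k) f j (zcoord (p j) w)) (fun w => g (zcoord b w))
  = cov U (fun w => Phi (stdv w)) (fun w => G (stdv w)).
  rewrite /cov !(mean_inj_stdv Phi) // (mean_inj_stdv G) //.
  rewrite (mean_inj_stdv (fun s => Phi s * G s)) //.
  have eP : {in inj_words N ds, forall w, \prod_(j < k) f j (zcoord (p j) w) = Phi (map succn w)}.
    move=> w wU; apply: eq_bigr => j _; rewrite (nth_map 0%N) // (inj_words_size wU).
    exact: pN.
  have eG : {in inj_words N ds, forall w, g (zcoord b w) = G (map succn w)}.
    by move=> w wU; rewrite /G (nth_map 0%N) // (inj_words_size wU).
  congr (_ - _ * _); apply: eq_mean => w wU; rewrite ?eP ?eG //.
have n0 : 0 < n%:R :> F.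
  by rewrite ltr0n lt0n; apply: contraTneq tn => ->; rewrite mulr0 -ltNge ltr01.
(* Since [n <= b < N], a large gap forces [N] to be large, which brings scaled letters close to
   scaled ranks. *)
have Nn : N.+1%:R^-1 <= t ^+ 2 :> F.
  rewrite -div1r ler_pdivrMr ?ltr0n //; apply: le_trans tn _.
  by rewrite ler_wpM2l ?sqr_ge0 // ler_nat; lia.
have eta i : (i < N)%N -> mean U (fun w => `|(nth 0%N (stdv w) i)%:R / N%:R - scoord F M i w|) <= 4 * t.
  move=> iN; apply: le_trans (mean_inj_zcoord NM iN t0) _.
  have h : 2 / N.+1%:R / t <= 2 * t.
    by rewrite ler_pdivrMr // -mulrA -expr2 ler_wpM2l.
  have : t ^+ 2 <= t by rewrite expr2 -[leRHS]mulr1 ler_wpM2l // ltW.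
  by move=> ht; apply: le_trans (lerD (lerD (lexx _) h) Nn) _; lra.
have S2 : `|cov U (fun w => Phi (stdv w)) (fun w => G (stdv w)) - cov U Psi H| <= 8 * l * k.+1%:R * t.
  apply: le_trans (norm_covB_le (fun w _ => Phi1 _) (fun w _ => G1 _) (fun w _ => Psi1 _) (fun w _ => H1 _)) _.
  have hP : mean U (fun w => `|Phi (stdv w) - Psi w|) <= k%:R * (l * (4 * t)).
    apply: (@le_trans _ _ (mean U (fun w => \sum_(j < k) l * `|(nth 0%N (stdv w) (p j))%:R / N%:R - scoord F M (p j) w|))).
      apply: ler_mean => w _.
      apply: le_trans (norm_prodB_le (a := fun j => f j ((nth 0%N (stdv w) (p j))%:R / N%:R)) (b := fun j => f j (scoord F M (p j) w)) _ _) _ => //.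
      by apply: ler_sum => j _; apply: fL.
    rewrite mean_sum; apply: (@le_trans _ _ (\sum_(j < k) l * (4 * t))); last first.
      by rewrite sumr_const card_ord -[leLHS]mulr_natl.
    apply: ler_sum => j _.
    by rewrite meanZ ler_wpM2l // eta // pN.
  have hG : mean U (fun w => `|G (stdv w) - H w|) <= l * (4 * t).
    apply: (@le_trans _ _ (mean U (fun w => l * `|(nth 0%N (stdv w) b)%:R / N%:R - scoord F M b w|))).
      by apply: ler_mean => w _; apply: gl.
    by rewrite meanZ ler_wpM2l // eta.
  by rewrite -natr1; lra.
have S3 : `|cov W Psi H - cov U Psi H| <= t.
  apply: le_trans dt.
  exact: norm_cov_change_le cl (@subset_inj_words M) (fun w _ => Psi1 w) (fun w _ => H1 w).
have S4 : `|cov W Psi H| <= t + 2 * l ^+ 2 * t.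
  have M0 : 0 < M.+1%:R :> F by rewrite ltr0n.
  have := @mean_words_peel F M ds a b (fun s => \prod_(j < k) f j ((nth 0%N s (p j)).+1%:R / M.+1%:R))
    (fun z => g (z.+1%:R / M.+1%:R)) (l / M.+1%:R) t.
  have ab : (a <= b)%N by apply: leq_trans anb; apply: leq_addr.
  have lM : 0 <= l / M.+1%:R by apply: divr_ge0 => //; apply: ltW.
  move=> /(_ ab bN t0 lM) peel.
  rewrite /cov (eq_mean (v := fun w => \prod_(j < k) f j ((nth 0%N (take a.+1 w) (p j)).+1%:R / M.+1%:R) * g ((nth 0%N w b).+1%:R / M.+1%:R))); last first.
    by move=> w _; congr (_ * _); apply: eq_bigr => j _; rewrite nth_take // ltnS pa.
  rewrite (eq_mean (u := Psi) (v := fun w => \prod_(j < k) f j ((nth 0%N (take a.+1 w) (p j)).+1%:R / M.+1%:R))); last first.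
    by move=> w _; apply: eq_bigr => j _; rewrite nth_take // ltnS pa.
  apply: le_trans (peel _ _) _.
  - move=> z _; apply: le_trans (gl _ _) _; rewrite -mulrBl -natrB // subSnn.
    by rewrite mul1r ger0_norm ?invr_ge0 // ltW.
  - move=> w _; exact: (norm_prod_le1 (a := fun j => f j ((nth 0%N (take a.+1 w) (p j)).+1%:R / M.+1%:R))).
  rewrite lerD2l ler_pdivrMr //.
  have dN1 : 3 * d * N%:R <= 1 by rewrite dN.
  have := cov_words_scoord_le NM cl dN1 anb bN.
  rewrite cov_scoord.
  move=> C2; rewrite exprMn -[leLHS]mulrA.
  rewrite [leRHS](_ : _ = l ^+ 2 * (2 * t ^+ 2)); last by ring.
  apply: ler_wpM2l; first exact: sqr_ge0.
  (* The covariance is at most [2 / n], hence at most [2 * t ^ 2]. *)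
  rewrite -(ler_pM2l n0); apply: le_trans C2 _.
  rewrite [leRHS](_ : _ = 2 * (t ^+ 2 * n%:R)); last by ring.
  by rewrite -[leLHS]mulr1 ler_wpM2l.
rewrite E1.
have -> : cov U (fun w => Phi (stdv w)) (fun w => G (stdv w)) =
  (cov U (fun w => Phi (stdv w)) (fun w => G (stdv w)) - cov U Psi H) -
  (cov W Psi H - cov U Psi H) + cov W Psi H by ring.
apply: le_trans (ler_normD _ _) _; apply: le_trans (lerD (ler_normB _ _) (lexx _)) _.
rewrite /decorrelation_rate; lra.
Qed.

(** Factors are split off one at a time, each at the cost of its covariance with the product of the
    earlier ones. *)
Lemma mean_prod_zcoord_close (r : nat) (p : nat -> nat) f l t n :
  0 <= l -> 0 < t -> t <= 1 -> 1 <= t ^+ 2 * n%:R ->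
  (forall j, (j.+1 < r)%N -> (p j + n <= p j.+1)%N) -> (p r.-1 < N)%N ->
  (forall j, lip1 l (f j)) -> inj_words N ds != [::] ->
  `|mean (inj_words N ds) (fun w => \prod_(j < r) f j (zcoord (p j) w)) -
    \prod_(j < r) mean (inj_words N ds) (fun w => f j (zcoord (p j) w))|
  <= r%:R * (decorrelation_rate r l * t).
Proof.
move=> l0 t0 t1 tn pn pN fl nU.
have mono i j : (i <= j)%N -> (j < r)%N -> (p i <= p j)%N.
  elim: j => [|j IH]; first by rewrite leqn0 => /eqP->.
  rewrite leq_eqVlt => /orP[/eqP->//|ij] jr; apply: leq_trans (IH ij (ltnW jr)) _.
  by apply: leq_trans (pn j jr); apply: leq_addr.
have f1 j x : `|f j x| <= 1 by case: (fl j).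
set B := _ * t.
pose P (k : nat) (w : seq nat) : F := \prod_(j < k) f j (zcoord (p j) w).
pose Q (k : nat) (w : seq nat) : F := f k (zcoord (p k) w).
have covB k : (k < r)%N -> `|cov (inj_words N ds) (P k) (Q k)| <= B.
  (* The first factor meets an empty product and has covariance 0; position [p k.+1] is at least [n]
     beyond [p k], the largest earlier position. *)
  case: k => [|k] kr.
    rewrite /cov (eq_mean (u := fun w => P 0%N w * Q 0%N w) (v := Q 0%N)) => [|w _]; last by rewrite /P big_ord0 mul1r.
    rewrite (eq_mean (u := P 0%N) (v := fun _ => 1)) => [|w _]; last by rewrite /P big_ord0.
    by rewrite mean_const // mul1r subrr normr0 mulr_ge0 ?decorrelation_rate_ge0 // ltW.
  have pk j : (j < k.+1)%N -> (p j <= p k)%N by move=> jk; apply: mono; lia.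
  have pkN : (p k.+1 < N)%N by apply: leq_ltn_trans pN; apply: mono; lia.
  apply: le_trans (cov_zcoord_small l0 t0 t1 tn pk (pn k kr) pkN fl (fl k.+1)) _.
  rewrite /B ler_pM2r // /decorrelation_rate !lerD2r; apply: ler_wpM2l; first by apply: mulr_ge0.
  by rewrite ler_nat.
suff H k : (k <= r)%N ->
  `|mean (inj_words N ds) (P k) - \prod_(j < k) mean (inj_words N ds) (Q j)| <= k%:R * B.
  exact: H.
elim: k => [|k IH] kr.
  rewrite big_ord0 (eq_mean (v := fun _ => 1)) => [|w _]; last by rewrite /P big_ord0.
  by rewrite mean_const // subrr normr0 mul0r.
rewrite big_ord_recr /= (eq_mean (v := fun w => P k w * Q k w)); last first.
  by move=> w _; rewrite /P big_ord_recr.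
have -> : mean (inj_words N ds) (fun w => P k w * Q k w) = cov (inj_words N ds) (P k) (Q k) +
   mean (inj_words N ds) (P k) * mean (inj_words N ds) (Q k) by rewrite /cov subrK.
rewrite -addrA -mulrBl; apply: le_trans (ler_normD _ _) _.
rewrite -[k.+1%:R]natr1 [leRHS]mulrDl mul1r addrC; apply: lerD; last exact: covB.
rewrite normrM -[leRHS]mulr1; apply: ler_pM => //; first by apply: IH; apply: ltnW.
by apply: norm_mean_le1 => w _; apply: f1.
Qed.

End Decorrelation.

(** * Permutations with a given descent set as words *)

Lemma fitsP ds w : reflect
  (size w = (size ds).+1 /\ forall p, (p < size ds)%N ->
     if nth false ds p then (nth 0 w p.+1 <= nth 0 w p)%N else (nth 0 w p <= nth 0 w p.+1)%N)
  (fits ds w).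
Proof.
elim: ds w => [|d ds IH] w.
  by case: w => [|x [|y w]] /=; constructor; [case|split|case].
case: w => [|x [|y w]]; try by constructor; case.
apply: (iffP andP) => [[dxy /IH[sw H]]|[sw H]]; split.
- by move: sw => /= [->].
- by case=> [|p] pd //=; apply: H.
- exact: (H 0%N).
- by apply/IH; split=> [|p pd]; [move: sw => /= [->] | apply: (H p.+1)].
Qed.

(** Bit [p] governs the step between the 0-based positions [p] and [p + 1], which is the 1-based
    descent position [p + 1]. *)
Definition descent_bits (N : nat) (D : seq nat) : seq bool := [seq p.+1 \in D | p <- iota 0 N.-1].

Lemma comp_descent_set_sub N lam : is_composition N lam ->
  {subset comp_descent_set lam <= iota 1 N.-1}.
Proof.
case=> pos sumN i /mapP[k]; rewrite mem_iota => kl ->.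
have sp (s : seq nat) : s != [::] -> all (fun x => 0 < x)%N s -> (0 < sumn s)%N.
  by case: s => [|x s] //= _ /andP[x0 _]; apply: ltn_addr.
have [k0 ks] : (0 < k)%N /\ (k < size lam)%N by lia.
have cat : (sumn (take k lam) + sumn (drop k lam) = N)%N by rewrite -sumn_cat cat_take_drop.
have pt : (0 < sumn (take k lam))%N.
  apply: sp; first by rewrite -size_eq0 size_take ks -lt0n.
  by move: pos; rewrite -{1}(cat_take_drop k lam) all_cat => /andP[].
have pd : (0 < sumn (drop k lam))%N.
  apply: sp; first by rewrite -size_eq0 size_drop -lt0n subn_gt0.
  by move: pos; rewrite -{1}(cat_take_drop k lam) all_cat => /andP[].
rewrite mem_iota; lia.
Qed.

(** Letters are values minus one. Between distinct letters a weak inequality is strict, so fitting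
    the pattern means having exactly this descent set. *)
Lemma perms_with_descents_words N lam : is_composition N lam -> (0 < N)%N ->
  perm_eq (perms_with_descents N lam)
    [seq map succn w | w <- inj_words N (descent_bits N (comp_descent_set lam))].
Proof.
move=> clam N0; set D := comp_descent_set lam; set ds := descent_bits N D.
have Dsub := comp_descent_set_sub clam; rewrite -/D in Dsub.
have sds : size ds = N.-1 by rewrite size_map size_iota.
have nds p : (p < N.-1)%N -> nth false ds p = (p.+1 \in D).
  by move=> pN; rewrite (nth_map 0%N) ?size_iota // nth_iota.
apply: uniq_perm.
- by rewrite filter_uniq // permutations_uniq.
- rewrite map_inj_uniq; first by rewrite filter_uniq // words_uniq.
  exact/inj_map/succn_inj.
move=> s; rewrite mem_filter mem_permutations; apply/idP/mapP.
  case/andP => /andP[/allP sD /allP Ds] ps.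
  have ss : size s = N by rewrite (perm_size ps) size_iota.
  have us : uniq s by rewrite (perm_uniq ps) iota_uniq.
  have sv v : v \in s -> (0 < v <= N)%N.
    by rewrite (perm_mem ps) mem_iota add1n ltnS.
  have e : map succn (map predn s) = s.
    by rewrite -map_comp -[RHS]map_id; apply/eq_in_map => v /sv /=; lia.
  exists (map predn s) => //; rewrite mem_inj_words.
  apply/and3P; split.
  - by rewrite -(map_inj_uniq succn_inj) e.
  - apply/fitsP; rewrite size_map ss sds; split=> [|p pN]; first by lia.
    rewrite nds // !(nth_map 0%N) ?ss; try lia.
    have pI : (p.+1 \in iota 1 N.-1) by rewrite mem_iota; lia.
    case: ifP => [/Ds|pD]; first by rewrite mem_filter /perm_val /= => /andP[]; lia.
    suff : ~~ (nth 0%N s p.+1 < nth 0%N s p)%N by lia.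
    apply/negP => lt; have : p.+1 \in perm_descents N s by rewrite mem_filter pI andbT.
    by move/sD; rewrite pD.
  - by rewrite all_map; apply/allP => v /sv /=; lia.
case=> w; rewrite mem_inj_words => /and3P[uw /fitsP[sw fw] wN] ->.
rewrite sds in sw fw; have {}sw : size w = N by rewrite sw prednK.
have pv p : (p < N)%N -> perm_val (map succn w) p.+1 = (nth 0%N w p).+1.
  by move=> pN; rewrite /perm_val (nth_map 0%N) ?sw.
have us : uniq (map succn w) by rewrite map_inj_uniq //; apply: succn_inj.
apply/andP; split; last first.
  have sub : {subset map succn w <= iota 1 N}.
    by move=> _ /mapP[v vw ->]; rewrite mem_iota; have := allP wN v vw; lia.
  apply: uniq_perm (iota_uniq _ _) _ => //.
  by apply: (uniq_min_size us sub _).2; rewrite size_iota size_map sw.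
apply/andP; split; apply/allP => i.
  rewrite mem_filter mem_iota => /andP[lt iN].
  case: i lt iN => // p lt pN; rewrite !pv in lt; try lia.
  by have := fw p; rewrite nds; last (by lia); case: (p.+1 \in D) => // /(_ ltac:(lia)); lia.
move=> iD; have := Dsub i iD; rewrite mem_iota => iN.
case: i iD iN => // p pD pN; rewrite mem_filter mem_iota !pv; try lia.
have := fw p; rewrite nds; last by lia.
rewrite pD => /(_ ltac:(lia)) le.
have ne : nth 0%N w p.+1 != nth 0%N w p by rewrite nth_uniq ?sw //; lia.
lia.
Qed.

(** * The Levy-Prokhorov distance *)

Section PartitionOfUnity.
Variables (F : realFieldType) (m : nat).
Hypothesis m_gt0 : (0 < m)%N.

Definition clamp (x : F) : F := if x <= 0 then 0 else if x <= 1 then x else 1.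

(** The hat function with peak 1 at [c / m] that vanishes at distance [1 / m] and beyond; written as
    a difference so that sums over [c] telescope. *)
Definition tent (c : nat) (x : F) : F := clamp (m%:R * x - c%:R + 1) - clamp (m%:R * x - c%:R).

Fixpoint tent_prod (c : seq nat) (z : seq F) : F :=
  if c is c0 :: c' then tent c0 (head 0 z) * tent_prod c' (behead z) else 1.

Lemma clamp_le x y : x <= y -> clamp x <= clamp y.
Proof.
move=> xy; rewrite /clamp.
by case: (lerP x 0) => ?; case: (lerP y 0) => ?; try case: (lerP x 1) => ?;
  try case: (lerP y 1) => ?; lra.
Qed.

Lemma clamp_itv x : 0 <= clamp x <= 1.
Proof. by rewrite /clamp; case: (lerP x 0) => ?; try case: (lerP x 1) => ?; lra. Qed.

Lemma clamp_lip x y : `|clamp x - clamp y| <= `|x - y|.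
Proof.
wlog xy : x y / y <= x.
  by move=> H; case: (leP y x) => [|/ltW] h; [|rewrite distrC [leRHS]distrC]; apply: H.
rewrite !ger0_norm ?subr_ge0 //; last exact: clamp_le.
rewrite /clamp.
by case: (lerP x 0) => ?; case: (lerP y 0) => ?; try case: (lerP x 1) => ?;
  try case: (lerP y 1) => ?; lra.
Qed.

Lemma clamp_eq0 x : x <= 0 -> clamp x = 0.
Proof. by rewrite /clamp => ->. Qed.

Lemma clamp_eq1 x : 1 <= x -> clamp x = 1.
Proof. by move=> x1; rewrite /clamp; case: (lerP x 0) => ?; try case: (lerP x 1) => ?; lra. Qed.

Lemma tent_itv c x : 0 <= tent c x <= 1.
Proof.
have /andP[a b] := clamp_itv (m%:R * x - c%:R); have /andP[a' b'] := clamp_itv (m%:R * x - c%:R + 1).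
have : clamp (m%:R * x - c%:R) <= clamp (m%:R * x - c%:R + 1) by apply: clamp_le; lra.
by rewrite /tent; lra.
Qed.

Lemma tent_lip1 c : lip1 (2 * m%:R) (tent c).
Proof.
split=> [x|x y]; first by rewrite ger0_norm; case/andP: (tent_itv c x).
have := clamp_lip (m%:R * x - c%:R + 1) (m%:R * y - c%:R + 1).
have := clamp_lip (m%:R * x - c%:R) (m%:R * y - c%:R).
rewrite (_ : _ + 1 - (_ + 1) = m%:R * (x - y)); last by ring.
rewrite (_ : m%:R * x - c%:R - _ = m%:R * (x - y)); last by ring.
rewrite normrM normr_nat => h1 h2; rewrite /tent.
set a := clamp _ in h2 *; set b := clamp _ in h1 *.
set a' := clamp _ in h2 *; set b' := clamp _ in h1 *.
rewrite (_ : a - _ - _ = (a - a') - (b - b')); last by ring.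
apply: le_trans (ler_normB _ _) _; lra.
Qed.

Lemma sum_tent x : 0 <= x <= 1 -> \sum_(c <- iota 0 m.+1) tent c x = 1.
Proof.
move=> /andP[x0 x1].
have H n : \sum_(c <- index_iota 0 n) tent c x = clamp (m%:R * x + 1) - clamp (m%:R * x + 1 - n%:R).
  elim: n => [|n IH]; first by rewrite big_geq // subr0 subrr.
  rewrite big_nat_recr //= IH /tent -[n.+1%:R]natr1 [m%:R * x - n%:R + 1]addrAC.
  rewrite (_ : m%:R * x + 1 - (n%:R + 1) = m%:R * x - n%:R); last by ring.
  ring.
have -> : iota 0 m.+1 = index_iota 0 m.+1 by [].
have mx0 : 0 <= m%:R * x by apply: mulr_ge0.
have mx1 : m%:R * x <= m%:R by rewrite -[leRHS]mulr1 ler_wpM2l.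
by rewrite H -natr1 clamp_eq1 ?clamp_eq0 ?subr0 //; lra.
Qed.

Lemma tent_gt0 c x : 0 < tent c x -> `|m%:R * x - c%:R| < 1.
Proof.
rewrite /tent ltr_norml => h; apply/andP; split; rewrite ltNge; apply/negP => le; move: h.
  by rewrite !clamp_eq0 ?subrr ?ltxx //; lra.
by rewrite !clamp_eq1 ?subrr ?ltxx //; lra.
Qed.

Lemma tent_close c x y : 0 < tent c x -> 0 < tent c y -> `|x - y| < 2 / m%:R.
Proof.
move=> /tent_gt0 hx /tent_gt0 hy; have m0 : 0 < m%:R :> F by rewrite ltr0n.
rewrite ltr_pdivlMr // mulrC -[X in X * _](gtr0_norm m0) -normrM.
rewrite (_ : _ * _ = (m%:R * x - c%:R) - (m%:R * y - c%:R)); last by ring.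
by apply: le_lt_trans (ler_normB _ _) _; lra.
Qed.

Lemma tent_prod_ge0 c z : 0 <= tent_prod c z.
Proof.
elim: c z => [|c0 c IH] z //=; apply: mulr_ge0 => //.
by case/andP: (tent_itv c0 (head 0 z)).
Qed.

Lemma tent_prodE c z : tent_prod c z = \prod_(j < size c) tent (nth 0%N c j) (nth 0 z j).
Proof.
elim: c z => [|c0 c IH] z /=; first by rewrite big_ord0.
rewrite big_ord_recl /= IH; congr (tent _ _ * _).
by apply: eq_bigr => j _; rewrite add0n; case: z => [|x z] /=; rewrite ?nth_nil.
Qed.

Lemma sum_tent_prod r z : size z = r -> all (fun x => 0 <= x <= 1) z ->
  \sum_(c <- all_seqs m.+1 r) tent_prod c z = 1.
Proof.
elim: r z => [|r IH] [|x z] // sz; first by rewrite big_seq1.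
case: sz => sz.
move=> /andP[x01 z01].
transitivity (\sum_(c0 <- iota 0 m.+1) \sum_(c <- all_seqs m.+1 r) tent c0 x * tent_prod c z).
  exact: (big_allpairs_dep (h := cons)).
rewrite -(sum_tent x01); apply: eq_bigr => c0 _.
by rewrite -mulr_sumr IH // mulr1.
Qed.

Lemma tent_prod_gt0 c z : 0 < tent_prod c z ->
  forall j, (j < size c)%N -> 0 < tent (nth 0%N c j) (nth 0 z j).
Proof.
elim: c z => [|c0 c IH] z //= h.
have ht : 0 <= tent c0 (head 0 z) by case/andP: (tent_itv c0 (head 0 z)).
have p0 : 0 <= tent_prod c (behead z) by apply: tent_prod_ge0.
have t_gt0 : 0 < tent c0 (head 0 z).
  by rewrite lt_neqAle ht andbT eq_sym; apply: contraTneq h => ->; rewrite mul0r ltxx.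
have p_gt0 : 0 < tent_prod c (behead z).
  by rewrite lt_neqAle p0 andbT eq_sym; apply: contraTneq h => ->; rewrite mulr0 ltxx.
by case=> [_|j jc]; [case: z t_gt0 {h ht p0 p_gt0} | have := IH _ p_gt0 j jc; case: z {h ht p0 t_gt0 p_gt0} => [|x z]; rewrite /= ?nth_nil].
Qed.

End PartitionOfUnity.

(** * Integrals against finitely supported measures *)

Section Integrals.

Definition fint (T : Type) (m : fmeas T) (phi : T -> R) : R := \sum_(p <- m) p.1 * phi p.2.

Lemma fm_evalE (T : Type) (m : fmeas T) A : fm_eval m A = fint m (fun x => indicator (A x)).
Proof.
elim: m => [|p m IH]; first by rewrite /fint big_nil.
by rewrite /fint big_cons /= IH.
Qed.

Lemma indicator_true (P : Prop) : P -> indicator P = 1 :> R.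
Proof. by rewrite /indicator; case: excluded_middle_informative. Qed.

Lemma indicator_itv (P : Prop) : 0 <= indicator P <= 1.
Proof.
by rewrite /indicator; case: excluded_middle_informative => ? ; apply/andP; split;
  rewrite ?R0E ?R1E ?lexx ?ler01.
Qed.

Lemma indicator_ge0 (P : Prop) : 0 <= indicator P.
Proof. by case/andP: (indicator_itv P). Qed.

Lemma indicator_le (P : Prop) (x : R) : 0 <= x -> (P -> 1 <= x) -> indicator P <= x.
Proof. by rewrite /indicator; case: excluded_middle_informative => // p _ /(_ p). Qed.

Lemma fint_unif (Omega : eqType) (T : Type) (Om : seq Omega) (f : Omega -> T) (phi : T -> R) :
  fint (unif_law Om f) phi = mean Om (fun w => phi (f w)).
Proof. by rewrite /fint big_map -mulr_sumr /= INRE mulrC. Qed.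

Lemma fint_prod_tent (m : nat) (ms : seq (fmeas R)) c : size c = size ms ->
  fint (fm_prod ms) (tent_prod m c) =
  \prod_(j < size ms) fint (nth [::] ms j) (tent m (nth 0%N c j)).
Proof.
elim: ms c => [|mu ms IH] [|c0 c] // sc.
  by rewrite /fint big_seq1 big_ord0 mulr1.
case: sc => sc; rewrite big_ord_recl -IH // /fint /= big_allpairs_dep /= mulr_suml.
apply: eq_bigr => p _; rewrite mulr_sumr; apply: eq_bigr => q _; exact: mulrACA.
Qed.

Lemma sum_fint (I T : Type) (r : seq I) (m : fmeas T) (phi : I -> T -> R) :
  \sum_(i <- r) fint m (phi i) = fint m (fun x => \sum_(i <- r) phi i x).
Proof. by rewrite /fint exchange_big; apply: eq_bigr => p _; rewrite mulr_sumr. Qed.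

Lemma fintZ (T : Type) (m : fmeas T) (c : R) (phi : T -> R) :
  c * fint m phi = fint m (fun x => c * phi x).
Proof. by rewrite /fint mulr_sumr; apply: eq_bigr => p _; rewrite mulrCA. Qed.

Definition cube_supported (r : nat) (m : fmeas (seq R)) :=
  forall p, p \in m -> [/\ 0 <= p.1, size p.2 = r & all (fun x : R => 0 <= x <= 1) p.2].

Lemma ler_fint r m (phi psi : seq R -> R) : cube_supported r m ->
  (forall z, size z = r -> all (fun x : R => 0 <= x <= 1) z -> phi z <= psi z) ->
  fint m phi <= fint m psi.
Proof.
move=> sm le; rewrite /fint big_seq [leRHS]big_seq; apply: ler_sum => p /sm[p0 sp cp].
by apply: ler_wpM2l => //; apply: le.
Qed.

Lemma cube_supported_unif (Omega : eqType) (Om : seq Omega) (f : Omega -> seq R) r :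
  {in Om, forall w, size (f w) = r /\ all (fun x : R => 0 <= x <= 1) (f w)} ->
  cube_supported r (unif_law Om f).
Proof.
move=> H p /mapP[w wO ->] /=; have [s c] := H w wO; split=> //.
by rewrite INRE RinvE invr_ge0.
Qed.

Lemma cube_supported_prod (ms : seq (fmeas R)) :
  (forall mu, mu \in ms -> forall p, p \in mu -> 0 <= p.1 /\ 0 <= p.2 <= 1) ->
  cube_supported (size ms) (fm_prod ms).
Proof.
elim: ms => [|mu ms IH] H p /=; first by rewrite inE => /eqP->; split; rewrite ?R1E.
case/allpairsPdep => p1 [q [p1m qm ->]] /=.
have [q0 sq cq] : [/\ 0 <= q.1, size q.2 = size ms & all (fun x : R => 0 <= x <= 1) q.2].
  by apply: IH qm => nu num; apply: H; rewrite inE num orbT.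
have [p0 cp] := H mu (mem_head _ _) p1 p1m.
by split; rewrite ?sq ?cp //; apply: mulr_ge0.
Qed.

(** Two points where the same tent product is positive differ by less than [2 / m] in each
    coordinate, so their squared distance is at most [4 * r / m ^ 2], which is below [e ^ 2]. *)
Lemma tent_prod_nbhd (m r : nat) (A : seq R -> Prop) (e : R) c z a :
  (0 < m)%N -> 0 < e -> 4 * r%:R < e ^+ 2 * m%:R -> size c = r ->
  A a -> size a = r -> 0 < tent_prod m c a ->
  size z = r -> 0 < tent_prod m c z -> nbhd A e z.
Proof.
move=> m0 e0 em sc Aa sa ca sz cz; exists a; split=> //.
have m0R : 0 < m%:R :> R by rewrite ltr0n.
have H : foldr (fun p acc => Rplus (pow (Rminus p.1 p.2) 2) acc) (IZR 0) (zip z a) <=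
   r%:R * (2 / m%:R) ^+ 2.
  elim: r c z a sc sa ca sz cz {em Aa} => [|r IH] [|c0 c] [|x z] [|y a] //=.
    by move=> *; rewrite mul0r R0E.
  move=> [sc] [sa] ca [sz] cz.
  have tx := @tent_prod_gt0 R m (c0 :: c) (x :: z) cz 0%N isT.
  have ty := @tent_prod_gt0 R m (c0 :: c) (y :: a) ca 0%N isT.
  have {tx ty} xy := tent_close m0 tx ty.
  have pos (c' : nat) (x' : R) (d : seq nat) (z' : seq R) : 0 < tent m c' x' * tent_prod m d z' -> 0 < tent_prod m d z'.
    move=> h; rewrite lt_neqAle tent_prod_ge0 // andbT eq_sym.
    by apply: contraTneq h => ->; rewrite mulr0 ltxx.
  have h := IH c z a sc sa (pos _ _ _ _ ca) sz (pos _ _ _ _ cz).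
  rewrite RplusE !RmultE R1E mulr1 RminusE -expr2 -[r.+1%:R]natr1 [leRHS]mulrDl mul1r addrC; apply: lerD h _.
  rewrite -real_normK ?num_real //; apply: lerXn2r; rewrite ?nnegrE ?divr_ge0 //; exact: ltW.
apply/RltP; rewrite /euclid_dist RsqrtE.
rewrite -[X in _ < X]ger0_norm ?(ltW e0) // -sqrtr_sqr ltr_sqrt ?exprn_gt0 //.
apply: le_lt_trans H _; rewrite expr_div_n mulrA ltr_pdivrMr ?exprn_gt0 //.
have m1 : 1 <= m%:R :> R by rewrite ler1n.
have : e ^+ 2 * m%:R <= e ^+ 2 * m%:R ^+ 2.
  by apply: ler_wpM2l; [apply: sqr_ge0 | rewrite expr2 -[leLHS]mulr1 ler_wpM2l].
move: em; rewrite (_ : 2 ^+ 2 = 4 :> R); last by ring.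
by move=> em; apply: lt_le_trans; rewrite mulrC.
Qed.

(** On the cube, the sum of the tent products that are positive somewhere on [A] lies between the
    indicators of [A] and of its neighbourhood; each of the [m.+1 ^ r] products costs [err]. *)
Lemma fm_eval_le_nbhd (m r : nat) (mu nu : fmeas (seq R)) (e err : R) A :
  (0 < m)%N -> 0 < e -> 4 * r%:R < e ^+ 2 * m%:R ->
  cube_supported r mu -> cube_supported r nu ->
  (forall c, size c = r -> `|fint mu (tent_prod m c) - fint nu (tent_prod m c)| <= err) ->
  fm_eval mu A <= fm_eval nu (nbhd A e) + (m.+1 ^ r)%:R * err.
Proof.
move=> m0 e0 em smu snu close; rewrite !fm_evalE.
pose good c := indicator (exists a, [/\ A a, size a = r & 0 < tent_prod m c a]).
have err0 : 0 <= err.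
  by apply: le_trans (close (nseq r 0%N) (size_nseq _ _)).
apply: (@le_trans _ _ (fint mu (fun z => \sum_(c <- all_seqs m.+1 r) good c * tent_prod m c z))).
  apply: ler_fint smu _ => z sz cz; apply: indicator_le => [|Az].
    by apply: sumr_ge0 => c _; apply: mulr_ge0; [apply: indicator_ge0 | apply: tent_prod_ge0].
  rewrite -(sum_tent_prod m sz cz); apply: ler_sum => c _.
  have [->|nz] := eqVneq (tent_prod m c z) 0; first by rewrite mulr0.
  rewrite /good indicator_true ?mul1r //; exists z; split=> //.
  by rewrite lt_neqAle eq_sym nz tent_prod_ge0.
rewrite -sum_fint.
apply: (@le_trans _ _ (\sum_(c <- all_seqs m.+1 r) (good c * fint nu (tent_prod m c) + err))).
  rewrite big_seq [leRHS]big_seq; apply: ler_sum => c; rewrite mem_all_seqs => /andP[_ /eqP sc].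
  rewrite -fintZ -lerBlDl -mulrBr; apply: le_trans (ler_norm _) _; rewrite normrM -[leRHS]mul1r.
  apply: ler_pM => //; last exact: close.
  by rewrite ger0_norm; case/andP: (indicator_itv (exists a, [/\ A a, size a = r & 0 < tent_prod m c a])).
rewrite big_split /= big_const_seq count_predT iter_addr_0 size_all_seqs -[X in _ + X]mulr_natl.
rewrite lerD2r; under eq_bigr do rewrite fintZ.
rewrite sum_fint; apply: ler_fint snu _ => z sz cz.
have [nz|far] := excluded_middle_informative (nbhd A e z).
  rewrite indicator_true // -(sum_tent_prod m sz cz); apply: ler_sum => c _.
  rewrite -[leRHS]mul1r; apply: ler_wpM2r; first exact: tent_prod_ge0.
  by case/andP: (indicator_itv (exists a, [/\ A a, size a = r & 0 < tent_prod m c a])).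
apply: le_trans (indicator_ge0 _); rewrite big_seq big1 // => c; rewrite mem_all_seqs => /andP[_ /eqP sc].
have [->|nz] := eqVneq (tent_prod m c z) 0; first by rewrite mulr0.
rewrite /good /indicator; case: excluded_middle_informative => h; last by rewrite R0E mul0r.
case: (h) => a [Aa sa ca]; case: far; apply: (@tent_prod_nbhd m r A e c z a) => //.
by rewrite lt_neqAle eq_sym nz tent_prod_ge0.
Qed.

End Integrals.

(** * From the neighbourhood condition to the distance *)

Section LevyProkhorov.
Local Open Scope R_scope.

(** [epsilon] yields the infimum once one exists. The set is bounded below by 0 and contains [eps];
    [completeness] concerns suprema and is applied to the negated set. *)
Lemma levy_prokhorov_le (mu nu : fmeas (seq R)) (eps : R) :
  (0 < eps) -> LP_cond mu nu eps -> (levy_prokhorov mu nu <= eps).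
Proof.
move=> e0 lp.
have ex : exists x, is_inf (fun e => (0 < e) /\ LP_cond mu nu e) x.
  have [||x [ub lub]] := completeness (fun x => (0 < - x) /\ LP_cond mu nu (- x)).
  - by exists 0 => x [x0 _]; Lra.lra.
  - by exists (- eps); rewrite Ropp_involutive.
  exists (- x); split=> [y [y0 ly]|b lb].
    have := ub (- y); rewrite Ropp_involutive => /(_ (conj y0 ly)); Lra.lra.
  have : (x <= - b) by apply: lub => y Ey; have := lb _ Ey; Lra.lra.
  Lra.lra.
have [+ _] := epsilon_spec (inhabits 0) _ ex; exact.
Qed.

End LevyProkhorov.

Section LevyProkhorovBound.

Lemma mean_map_perm (S T : eqType) (Om : seq T) (Om' : seq S) (h : S -> T) (u : T -> R) :
  perm_eq Om (map h Om') -> mean Om u = mean Om' (fun w => u (h w)).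
Proof. by move=> pO; rewrite /mean (perm_big _ pO) big_map (perm_size pO) size_map. Qed.

(** * The two laws of a fixed composition tested against tent products *)

Section FixedComposition.
Variables (N : nat) (lam : seq nat) (i : nat -> nat) (r : nat).
Hypotheses (lamN : is_composition N.+1 lam) (i_gt0 : forall j, (j < r)%N -> (0 < i j)%N)
  (i_le : forall j, (j < r)%N -> (i j <= N.+1)%N).
Let ds := descent_bits N.+1 (comp_descent_set lam).
Let p j := (i j).-1.

Lemma size_descent_bits : size ds = N.
Proof. by rewrite size_map size_iota. Qed.

Lemma mean_perms_words (u : seq nat -> R) :
  mean (perms_with_descents N.+1 lam) u =
  mean (inj_words (size ds).+1 ds) (fun w => u (map succn w)).
Proof. by apply: mean_map_perm; rewrite size_descent_bits; apply: perms_with_descents_words. Qed.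

Lemma perm_val_zcoord w j : w \in inj_words (size ds).+1 ds -> (j < r)%N ->
  Rdiv (INR (perm_val (map succn w) (i j))) (INR N.+1) = zcoord R ds (p j) w.
Proof.
move=> wU jr; rewrite RdivE !INRE /zcoord size_descent_bits /perm_val (nth_map 0%N) //.
by rewrite (inj_words_size wU) size_descent_bits; have := i_gt0 jr; have := i_le jr; rewrite /p; lia.
Qed.

Lemma fint_joint_tent m c : size c = r ->
  fint (joint_law N.+1 lam i r) (tent_prod m c) =
  mean (inj_words (size ds).+1 ds) (fun w => \prod_(j < r) tent m (nth 0%N c j) (zcoord R ds (p j) w)).
Proof.
move=> sc; rewrite fint_unif mean_perms_words; apply: eq_mean => w wU.
rewrite tent_prodE sc; apply: eq_bigr => j _; congr tent.
by rewrite (nth_map 0%N) ?size_iota // nth_iota // add0n perm_val_zcoord.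
Qed.

Lemma fint_prod_marginals_tent m c : size c = r ->
  fint (prod_marginals N.+1 lam i r) (tent_prod m c) =
  \prod_(j < r) mean (inj_words (size ds).+1 ds) (fun w => tent m (nth 0%N c j) (zcoord R ds (p j) w)).
Proof.
move=> sc; rewrite fint_prod_tent size_map size_iota //; apply: eq_bigr => j _.
rewrite (nth_map 0%N) ?size_iota // nth_iota // add0n fint_unif mean_perms_words.
by apply: eq_mean => w wU; rewrite perm_val_zcoord.
Qed.

Lemma perm_ratio_itv s k : s \in perms_with_descents N.+1 lam ->
  0 <= Rdiv (INR (perm_val s k)) (INR N.+1) <= 1.
Proof.
rewrite mem_filter mem_permutations => /andP[_ ps].
rewrite RdivE !INRE divr_ge0 //= ler_pdivrMr ?ltr0n // mul1r ler_nat /perm_val.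
have [ks|ks] := ltnP k.-1 (size s); last by rewrite nth_default.
by have := mem_nth 0%N ks; rewrite (perm_mem ps) mem_iota add1n ltnS => /andP[].
Qed.

Lemma cube_supported_joint : cube_supported r (joint_law N.+1 lam i r).
Proof.
apply: cube_supported_unif => s sP; split; first by rewrite size_map size_iota.
by apply/allP => x /mapP[j _ ->]; apply: perm_ratio_itv.
Qed.

Lemma cube_supported_prod_marginals : cube_supported r (prod_marginals N.+1 lam i r).
Proof.
have := @cube_supported_prod [seq marginal_law N.+1 lam (i j) | j <- iota 0 r].
rewrite size_map size_iota; apply=> mu /mapP[j _ ->] q /mapP[s sP ->] /=.
by split; [rewrite INRE RinvE invr_ge0 | apply: perm_ratio_itv].
Qed.

Lemma fint_tent_close m (t : R) (n : nat) c : (0 < r)%N -> 0 < t -> t <= 1 -> 1 <= t ^+ 2 * n%:R ->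
  (forall j, (j.+1 < r)%N -> (i j + n <= i j.+1)%N) -> size c = r ->
  `|fint (joint_law N.+1 lam i r) (tent_prod m c) - fint (prod_marginals N.+1 lam i r) (tent_prod m c)|
  <= r%:R * (decorrelation_rate r (2 * m%:R) * t).
Proof.
move=> r0 t0 t1 tn gap sc; rewrite fint_joint_tent // fint_prod_marginals_tent //.
have l0 : 0 <= 2 * m%:R :> R by apply: mulr_ge0.
(* Over an empty list both integrals are 0, the product of marginals because [r] is positive. *)
have [->|nU] := eqVneq (inj_words (size ds).+1 ds) [::].
  rewrite mean_nil (eq_bigr (fun _ => 0)) => [|j _]; last by rewrite mean_nil.
  rewrite prodr_const card_ord expr0n eqn0Ngt r0 subrr normr0.
  by do 2 apply: mulr_ge0 => //; [apply: decorrelation_rate_ge0 | apply: ltW].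
have pgap j : (j.+1 < r)%N -> (p j + n <= p j.+1)%N.
  by move=> jr; have := gap j jr; have := i_gt0 (ltnW jr); rewrite /p; lia.
have pN : (p r.-1 < (size ds).+1)%N.
  have rr : (r.-1 < r)%N by rewrite prednK.
  by rewrite size_descent_bits; have := i_le rr; have := i_gt0 rr; rewrite /p; lia.
exact: (mean_prod_zcoord_close (f := fun j => tent m (nth 0%N c j)) l0 t0 t1 tn pgap pN
  (fun j => tent_lip1 R m (nth 0%N c j)) nU).
Qed.

End FixedComposition.

Lemma LP_cond_uniform (eps : R) (r : nat) : 0 < eps -> (0 < r)%N ->
  exists n : nat, forall (N : nat) (lam : seq nat) (i : nat -> nat),
    is_composition N lam -> (1 <= i 0%N)%N -> (i r.-1 <= N)%N ->
    (forall j : nat, (j.+1 < r)%N -> (i j < i j.+1)%N /\ (i j + n <= i j.+1)%N) ->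
    LP_cond (joint_law N lam i r) (prod_marginals N lam i r) eps.
Proof.
move=> e0 r0; have e20 : 0 < eps ^+ 2 by rewrite exprn_gt0.
have b0 : 0 <= 4 * r%:R / eps ^+ 2 by apply: divr_ge0; [apply: mulr_ge0 | apply: ltW].
(* The mesh is fine enough that points under one tent product are within [eps]. *)
pose m := (Num.bound (4 * r%:R / eps ^+ 2)).+1.
have em : 4 * r%:R < eps ^+ 2 * m%:R.
  rewrite [ltRHS]mulrC -ltr_pdivrMr //; apply: lt_le_trans (archi_boundP b0) _.
  by rewrite ler_nat.
pose C := @decorrelation_rate R r (2 * m%:R).
have C0 : 0 <= C by apply: decorrelation_rate_ge0; apply: mulr_ge0.
pose K := (m.+1 ^ r)%:R * (r%:R * C) + 1.
have K0 : 0 < K by rewrite ltr_wpDl // mulr_ge0 // mulr_ge0.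
(* The errors of all [m.+1 ^ r] tent products then add up to at most [eps]; the summand 1 in [K]
   keeps the quotient meaningful. *)
pose t := Num.min 1 (eps / K).
have t0 : 0 < t by rewrite lt_min ltr01 divr_gt0.
have t1 : t <= 1 by rewrite ge_min lexx.
have Kt : (m.+1 ^ r)%:R * (r%:R * (C * t)) <= eps.
  have h : t * K <= eps by rewrite -ler_pdivlMr // ge_min lexx orbT.
  apply: le_trans h; rewrite !mulrA [leRHS]mulrC ler_wpM2r ?(ltW t0) // /K !mulrA lerDl //.
have i0 : 0 <= (t ^+ 2)^-1 by rewrite invr_ge0 sqr_ge0.
(* The gap exceeds [1 / t ^ 2], and [t] depends only on [eps] and [r]. *)
exists (Num.bound (t ^+ 2)^-1) => N lam i lamN i1 iN gap.
have tn : 1 <= t ^+ 2 * (Num.bound (t ^+ 2)^-1)%:R.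
  rewrite -ler_pdivrMl ?exprn_gt0 // mulr1; exact: ltW (archi_boundP i0).
have mono j k : (j <= k)%N -> (k < r)%N -> (i j <= i k)%N.
  elim: k => [|k IH]; first by rewrite leqn0 => /eqP->.
  rewrite leq_eqVlt => /orP[/eqP->//|jk] kr; apply: leq_trans (IH jk (ltnW kr)) _.
  by apply: ltnW; case: (gap k kr).
have i_gt0 j : (j < r)%N -> (0 < i j)%N by move=> jr; apply: leq_trans i1 (mono _ _ (leq0n j) jr).
have i_le j : (j < r)%N -> (i j <= N)%N.
  by move=> jr; apply: leq_trans iN; apply: mono; lia.
case: N lamN iN i_le => [|N] lamN iN i_le; first by have := i_gt0 0%N r0; have := i_le 0%N r0; lia.
have close c := @fint_tent_close N lam i r lamN i_gt0 i_le m t _ c r0 t0 t1 tn (fun j jr => (gap j jr).2).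
have sj : cube_supported r (joint_law N.+1 lam i r) by apply: cube_supported_joint.
have sp : cube_supported r (prod_marginals N.+1 lam i r) by apply: cube_supported_prod_marginals.
move=> A; split; apply/RleP.
  apply: le_trans (fm_eval_le_nbhd A (ltn0Sn _) e0 em sj sp close) _.
  by rewrite lerD2l.
have close' c : size c = r -> `|fint (prod_marginals N.+1 lam i r) (tent_prod m c) -
    fint (joint_law N.+1 lam i r) (tent_prod m c)| <= r%:R * (C * t).
  by move=> sc; rewrite distrC; apply: close.
apply: le_trans (fm_eval_le_nbhd A (ltn0Sn _) e0 em sp sj close') _.
by rewrite lerD2l.
Qed.

End LevyProkhorovBound.

Open Scope R_scope.

Theorem mainTheorem1 (eps : R) (r : nat) :
  0 < eps -> (1 <= r)%N ->
  exists n : nat,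
    forall (N : nat) (lam : seq nat) (i : nat -> nat),
      is_composition N lam ->
      (1 <= i 0%N)%N -> (i r.-1 <= N)%N ->
      (forall j : nat, (j.+1 < r)%N -> (i j < i j.+1)%N /\ (i j + n <= i j.+1)%N) ->
      levy_prokhorov (joint_law N lam i r) (prod_marginals N lam i r) <= eps.
Proof.
move=> e0 r0; have /RltP e0' := e0.
have [n H] := LP_cond_uniform e0' r0.
exists n => N lam i lamN i1 iN gap; apply: levy_prokhorov_le => //.
exact: H.
Qed.
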